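(* The Bellman equation $$v(s)=\sup_{a\in A(s)}\left((1-\beta)u(s,a)^p+\beta\left[\frac1r\ln\int_S e^{rv(s')}q(ds'|s,a)\right]^p\right)^{1/p}\quad\text{for all } s\in S$$ has exactly one solution $v=v^*$ in the class $\widehat{\mathcal A}$.
   Context: Model. $S$ (states) and $A$ (actions) are Borel spaces, i.e. non-empty Borel subsets of complete separable metric spaces. $\mathbb K\subset S\times A$ is a non-empty Borel set such that each section $A(s)=\{a\in A:(s,a)\in\mathbb K\}$, $s\in S$, is non-empty. $q$ is a Borel measurable transition probability from $\mathbb K$ to $S$. $u:\mathbb K\to\mathbb R$ is Borel measurable with $b_0\le u(s,a)\le b_1$ for all $(s,a)\in\mathbb K$, where $b_1>b_0>0$ are constants. $\beta\in[0,1)$, $r<0$, and $p<1$, $p\ne0$ are fixed real parameters. Constants. $0<\epsilon<B$ are fixed constants chosen as follows: if $p<0$, then $\epsilon\le b_0$ and $B\ge(1-\beta)^{1/p}b_1$; if $p\in(0,1)$, then $\epsilon\le(1-\beta)^{1/p}b_0$ and $B\ge b_1$. Function class. A subset of a Borel space $Y$ is analytic if it is the projection onto $Y$ of a Borel subset of $Y\times Y$. A function $g:Y\to\mathbb R$ is upper semianalytic if $\{y:g(y)>c\}$ is analytic for every $c\in\mathbb R$ (such functions are universally measurable; integrals are taken with respect to completed measures). $\widehat{\mathcal A}$ is the set of all upper semianalytic functions $v:S\to[\epsilon,B]$. *)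

(* Defs.v *)
From HB Require Import structures.
From mathcomp Require Import all_boot all_order all_algebra.
From mathcomp Require Import all_classical all_reals all_analysis.

Set Implicit Arguments.
Unset Strict Implicit.
Unset Printing Implicit Defensive.

Import Order.TTheory GRing.Theory Num.Theory.
Import numFieldNormedType.Exports.

Local Open Scope classical_set_scope.
Local Open Scope ring_scope.

(* [Complete] is a pointed structure; this is harmless here, since only the
   non-empty subsets of such spaces are used. *)
#[short(type="completeMetricType")]
HB.structure Definition CompleteMetric (R : numDomainType) :=
  { T of Metric R T & Complete T }.

Definition separable (T : topologicalType) : Prop :=
  exists2 D : set T, countable D & dense D.

Definition borel_set (T : topologicalType) (E : set T) : Prop :=
  <<s @open T >> E.

(* A subset is used as a space in its own right through the coercion
   [set_type], which carries the subspace topology; its Borel sigma-algebra is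
   the one generated by that topology. *)
Notation borel T := (g_sigma_algebraType (@open T)).

Record nonemptyBorel (T : topologicalType) := NonemptyBorel {
  carrier :> set T ;
  carrier_borel : borel_set carrier ;
  carrier_neq0 : carrier !=set0 }.

(* Measurable types are pointed in the library: any point will do. *)
Definition nonemptyBorel_point (T : topologicalType) (E : nonemptyBorel T) :
    set_type E :=
  let: exist x Ex := cid (carrier_neq0 E) in exist _ x (mem_set Ex).

HB.instance Definition _ (T : topologicalType) (E : nonemptyBorel T) :=
  isPointed.Build (set_type (carrier E)) (nonemptyBorel_point E).

Definition analytic (Y : topologicalType) (E : set Y) : Prop :=
  exists2 C : set (Y * Y), borel_set C & E = fst @` C.

Definition upper_semianalytic (R : realType) (Y : topologicalType)
    (g : Y -> R) : Prop :=
  forall c : R, analytic [set y | c < g y].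

Definition Ahat (R : realType) (S : topologicalType) (eps B : R) :
    set (S -> R) :=
  [set v | upper_semianalytic v /\ forall s, eps <= v s <= B].

(* [v] need not be Borel measurable, hence the completed measure. *)
Definition entropic (R : realType) (S : ptopologicalType) (r : R)
    (m : {measure set (borel S) -> \bar R}) (v : S -> R) : R :=
  r^-1 * ln (\int[@completed_measure_extension _ _ _ m]_s expR (r * v s)).

(* A pair [k : K] with [(\val k).1 = s] is (s, a) with a in the section A(s).
   For [u] bounded between positive constants, [q] stochastic and [v] with
   values in some [eps, B], 0 < eps, the set below is bounded (and non-empty),
   so that [sup] is the genuine supremum. *)
Definition bellman_solution (R : realType) (X Y : topologicalType)
    (S : nonemptyBorel X) (A : nonemptyBorel Y) (K : nonemptyBorel (S * A)%type)
    (q : R.-pker (borel K) ~> (borel S)) (u : K -> R)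
    (beta r p : R) (v : S -> R) : Prop :=
  forall s : S, v s =
    sup [set ((1 - beta) * (u k `^ p)
              + beta * (entropic r (q k) v `^ p)) `^ p^-1
        | k in [set k : K | (\val k).1 = s]].

(* Main.v *)
(* The Bellman operator T is monotone, and r < 0 makes the certainty equivalent
   M v = r^-1 ln (E e^(r v)) satisfy M (t v) >= t M v for 0 < t <= 1 (Jensen).
   Since u is bounded away from 0, the continuation value enters the aggregator
   with a relative weight of at most theta < 1, so v >= t w implies
   T v >= t' T w where t'^p - 1 = theta (t^p - 1).  Iterating this from
   t = eps / B forces t -> 1, which gives uniqueness and shows that the
   increasing iterates of T from the constant eps converge to a fixed point.

   T preserves upper semianalyticity because analytic sets are exactly the
   sets obtained by the Souslin operation from Borel sets: for such a set E the
   capacitability argument expresses q(E | k) > c by the existence of a branch z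
   such that q(G_n(z) | k) >= c' > c for all n, with G_n(z) Borel and depending
   on finitely many terms of z, which is again a Souslin condition on k.
   Integrals are then reached through sums over level sets.  To come back from
   Souslin sets to projections of Borel subsets of S x S, one needs a Borel map
   from S onto the Baire space when S is uncountable, i.e. the perfect set
   theorem. *)

Require Import Defs.
From HB Require Import structures.
From mathcomp Require Import all_boot all_order all_algebra.
From mathcomp Require Import all_classical all_reals all_analysis.
From mathcomp Require Import measurable_realfun ring lra.

Set Implicit Arguments.
Unset Strict Implicit.
Unset Printing Implicit Defensive.

Import Order.TTheory GRing.Theory Num.Theory.
Import numFieldNormedType.Exports.

Local Open Scope classical_set_scope.
Local Open Scope ring_scope.

(** * Souslin sets parametrised by the Baire space *)

(** Relations between a point and a sequence replace the Souslin operation: witnesses, codes of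
    actions and branches can all be packed into one sequence, so closure under countable unions,
    intersections and projections is bookkeeping with [pr] and [join]. A Polish space enters through
    a surjection from the Baire space along which Borel sets pull back to relations that are Souslin
    together with their complements ([codable], [bisouslin]). This is enough to turn an existential
    over actions into a projection along sequences, and it asks for no sigma-algebra on the Baire
    space. On the analytic side, the estimate on T is linear once written for t^p: the number t^p -
    1 is multiplied by theta at each step. The sign of t^p - 1 and the monotonicity of x^(1/p) both
    flip with the sign of p, so the cases p < 0 and p > 0 run in parallel. *)

Notation baire := (nat -> nat).

Definition agree (m : nat) (x y : baire) := forall i, (i < m)%N -> x i = y i.

(** The modulus [m] is uniform in [x]. Hence [ctn] is uniform continuity, and compositions only
    require bounds on prefix lengths. *)
Definition findep (U : Type) (f : baire -> U) :=
  exists m, forall x y, agree m x y -> f x = f y.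

Definition ctn (g : baire -> baire) := forall n, findep (fun x => g x n).

Definition pr (i : nat) (x : baire) : baire := fun n => x (pickle (i, n)).

Definition join (f : nat -> baire) : baire :=
  fun k => if unpickle k is Some (i, n) then f i n else 0%N.

Lemma pr_join f i : pr i (join f) = f i.
Proof. by apply/funext => n; rewrite /pr /join pickleK. Qed.

Lemma agree_le m n x y : (m <= n)%N -> agree n x y -> agree m x y.
Proof. by move=> mn xy i im; apply: xy; exact: leq_trans mn. Qed.

Lemma agree_mkseq m x : agree m x (nth 0%N (mkseq x m)).
Proof. by move=> i im; rewrite nth_mkseq. Qed.

Lemma findep_comp U U' (h : U -> U') (f : baire -> U) :
  findep f -> findep (h \o f).
Proof. by move=> [m fm]; exists m => x y /fm /= ->. Qed.

Lemma ctn_agree g : ctn g ->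
  forall m, exists m', forall x y, agree m' x y -> agree m (g x) (g y).
Proof.
move=> gc; elim=> [|m [m' IH]]; first by exists 0%N.
have [k gk] := gc m; exists (maxn m' k) => x y xy i; rewrite ltnS leq_eqVlt.
move=> /orP[/eqP ->|im].
  by apply: gk; apply: agree_le xy; rewrite leq_maxr.
by apply: IH => //; apply: agree_le xy; rewrite leq_maxl.
Qed.

Lemma findep_ctn U (f : baire -> U) g : ctn g -> findep f -> findep (f \o g).
Proof.
move=> gc [m fm]; have [m' gm] := ctn_agree gc m.
by exists m' => x y /gm /fm.
Qed.

Lemma findep_coord n : findep (fun x : baire => x n).
Proof. by exists n.+1 => x y; apply. Qed.

Lemma ctn_pr i : ctn (pr i).
Proof. by move=> n; exact: findep_coord. Qed.

Lemma ctn_comp g h : ctn g -> ctn h -> ctn (g \o h).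
Proof. by move=> gc hc n; apply: (findep_ctn hc (gc n)). Qed.

Section souslin.
Context d (T : measurableType d).
Implicit Types (V W : T -> baire -> Prop) (E : set T).

(* [V s x] is measurable in [s] and closed in [x], jointly: a countable conjunction
   of conditions on [s] that depend on finitely many terms of [x]. *)
Definition closed_rel V := exists Q : nat -> baire -> set T,
  [/\ forall j x, measurable (Q j x), forall j, findep (Q j) &
      forall s x, V s x <-> forall j, Q j x s].

Lemma closed_rel_forall (I : countType) (V : I -> T -> baire -> Prop) :
  (forall i, closed_rel (V i)) -> closed_rel (fun s x => forall i, V i s x).
Proof.
move=> /choice[Q QP].
exists (fun n x => if unpickle n is Some (i, j) then Q i j x else setT).
split=> [n x|n|s x].
- case: unpickle => [[i j]|]; last exact: measurableT.
  by have [+ _ _] := QP i; apply.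
- case: unpickle => [[i j]|]; first by have [_ + _] := QP i; apply.
  by exists 0%N.
- split=> [Vs n|H i].
    by case: unpickle => [[i j]|//]; have [_ _ /(_ s x)[+ _]] := QP i; apply.
  have [_ _ /(_ s x)[_]] := QP i; apply => j.
  by have := H (pickle (i, j)); rewrite pickleK.
Qed.

Lemma closed_rel_set (C : baire -> set T) : (forall x, measurable (C x)) ->
  findep C -> closed_rel (fun s x => C x s).
Proof. by move=> mC fC; exists (fun=> C); split => // s x; split=> // /(_ 0%N). Qed.

Lemma closed_rel_imp (C : baire -> Prop) V : findep C -> closed_rel V ->
  closed_rel (fun s x => C x -> V s x).
Proof.
move=> [m Cm] [Q [mQ fQ VQ]]; exists (fun j x => [set s | C x -> Q j x s]).
split=> [j x|j|s x].
- have [Cx|nCx] := pselect (C x).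
    by rewrite (_ : [set _ | _] = Q j x)//; apply/seteqP; split=> s /=; tauto.
  by rewrite (_ : [set _ | _] = setT)//; apply/seteqP; split=> s /=; tauto.
- have [k Qk] := fQ j; exists (maxn m k) => x y xy.
  rewrite (Cm x y) ?(Qk x y)//; apply: agree_le xy;
    by rewrite ?leq_maxl ?leq_maxr.
- by split=> [H j /H/VQ//|H Cx]; apply/VQ => j; exact: H.
Qed.

Lemma closed_rel_ctn g V : ctn g -> closed_rel V ->
  closed_rel (fun s x => V s (g x)).
Proof.
move=> gc [Q [mQ fQ VQ]]; exists (fun j x => Q j (g x)); split=> // j.
exact: (findep_ctn gc (fQ j)).
Qed.

Lemma closed_rel_prop (C : baire -> Prop) : findep C ->
  closed_rel (fun _ x => C x).
Proof.
move=> fC; apply: (@closed_rel_set (fun x => [set _ | C x])) => [x|].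
  have [Cx|nCx] := pselect (C x).
    by rewrite (_ : [set _ | _] = setT)//; apply/seteqP; split=> s /=; tauto.
  by rewrite (_ : [set _ | _] = set0)//; apply/seteqP; split=> s /=; tauto.
exact: (@findep_comp _ _ (fun P : Prop => [set _ : T | P])).
Qed.

Lemma closed_rel_ext V V' : (forall s x, V s x <-> V' s x) ->
  closed_rel V -> closed_rel V'.
Proof.
move=> VV' [Q [mQ fQ VQ]]; exists Q; split=> // s x.
by rewrite -VV'; exact: VQ.
Qed.

Lemma closed_rel_eq g h : ctn g -> ctn h -> closed_rel (fun _ x => g x = h x).
Proof.
move=> gc hc.
apply: (@closed_rel_ext (fun _ x => forall n, g x n = h x n)).
  by move=> _ x; split=> [/funext|->].
apply: closed_rel_forall => n; apply: (@closed_rel_prop (fun x => g x n = h x n)).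
have [a ga] := gc n; have [b hb] := hc n; exists (maxn a b) => x y xy.
by rewrite (ga x y) ?(hb x y)//; apply: agree_le xy;
  rewrite ?leq_maxl ?leq_maxr.
Qed.

Lemma closed_rel_and V V' : closed_rel V -> closed_rel V' ->
  closed_rel (fun s x => V s x /\ V' s x).
Proof.
move=> cV cV'.
apply: (@closed_rel_ext (fun s x => forall b, (if b then V else V') s x)).
  by move=> s x; split=> [H|[? ?] []//]; split; [exact: (H true)|exact: (H false)].
by apply: closed_rel_forall => -[].
Qed.

(* Projections of closed relations, with [x] and the projected variable coded
   together into [y]. *)
Definition souslin_rel W := exists2 V, closed_rel V &
  forall s x, W s x <-> exists y, pr 0 y = x /\ V s y.

Lemma souslin_rel_ext W W' : (forall s x, W s x <-> W' s x) -> souslin_rel W ->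
  souslin_rel W'.
Proof. by move=> WW' [V cV VP]; exists V => // s x; rewrite -WW'. Qed.

Lemma souslin_rel_closed V : closed_rel V -> souslin_rel V.
Proof.
move=> cV; exists (fun s y => V s (pr 0 y)).
  by apply: closed_rel_ctn => //; exact: ctn_pr.
move=> s x; split=> [Vsx|[y [<-//]]].
by exists (join (fun=> x)); rewrite pr_join.
Qed.

(** Two successive projections merge into one: the new witness packs [x] beside the inner witness
    [z], and a closed equation between slices ties the two together. *)
Lemma souslin_rel_exists (W : T -> baire -> Prop) :
  souslin_rel W -> souslin_rel (fun s x => exists y, pr 0 y = x /\ W s y).
Proof.
move=> [V cV VP]; exists (fun s y => pr 0 (pr 0 (pr 1 y)) = pr 0 y /\ V s (pr 1 y)).
  apply: closed_rel_and; last by apply: closed_rel_ctn => //; exact: ctn_pr.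
  apply: (@closed_rel_eq (pr 0 \o (pr 0 \o pr 1))); last exact: ctn_pr.
  by do ?apply: ctn_comp; exact: ctn_pr.
move=> s x; split=> [[y [yx /VP[z [zy Vz]]]]|[y [yx [e Vy]]]].
  exists (join (fun i => if i == 0%N then x else z)).
  by rewrite !pr_join/= zy.
exists (pr 0 (pr 1 y)); split; first by rewrite e.
by apply/VP; exists (pr 1 y).
Qed.

Lemma souslin_rel_ctn g W : ctn g -> souslin_rel W -> souslin_rel (fun s x => W s (g x)).
Proof.
move=> gc [V cV VP].
exists (fun s y => pr 0 (pr 1 y) = g (pr 0 y) /\ V s (pr 1 y)).
  apply: closed_rel_and; last by apply: closed_rel_ctn => //; exact: ctn_pr.
  by apply: (@closed_rel_eq (pr 0 \o pr 1) (g \o pr 0)); apply: ctn_comp => //; exact: ctn_pr.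
move=> s x; split=> [/VP[y [yx Vy]]|[y [yx [e Vy]]]].
  exists (join (fun i => if i == 0%N then x else y)).
  by rewrite !pr_join.
by apply/VP; exists (pr 1 y); rewrite e yx.
Qed.

(** Countable choice gives one witness for each [i], and all of them are joined into one sequence.
    Slot 0 is kept for [x], hence the shift in [p]. *)
Lemma souslin_rel_forall (I : countType) (W : I -> T -> baire -> Prop) :
  (forall i, souslin_rel (W i)) -> souslin_rel (fun s x => forall i, W i s x).
Proof.
move=> nW; have /choice[V /all_and2[cV VP]] i : exists V,
    closed_rel V /\ forall s x, W i s x <-> exists y, pr 0 y = x /\ V s y.
  by have [V ? ?] := nW i; exists V.
pose p (i : I) := pr (pickle i).+1.
exists (fun s y => forall i, pr 0 (p i y) = pr 0 y /\ V i s (p i y)).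
  apply: closed_rel_forall => i; apply: closed_rel_and; last first.
    by apply: closed_rel_ctn => //; exact: ctn_pr.
  apply: (@closed_rel_eq (pr 0 \o p i)); last exact: ctn_pr.
  by apply: ctn_comp; exact: ctn_pr.
move=> s x; split=> [Ws|[y [yx Vy]] i]; last first.
  by have [e Vi] := Vy i; apply/VP; exists (p i y); rewrite e.
have /choice[y yP] i : exists y, pr 0 y = x /\ V i s y by apply/VP.
exists (join (fun n => if n is n'.+1 then
  if unpickle n' is Some i then y i else x else x)).
rewrite pr_join; split=> // i.
by rewrite /p pr_join pickleK.
Qed.

(** The chosen index is coded in the witness, as the first term of slot 2, so that the projection
    absorbs the union. *)
Lemma souslin_rel_exist (I : countType) (W : I -> T -> baire -> Prop) :
  (forall i, souslin_rel (W i)) -> souslin_rel (fun s x => exists i, W i s x).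
Proof.
move=> nW; have /choice[V /all_and2[cV VP]] i : exists V,
    closed_rel V /\ forall s x, W i s x <-> exists y, pr 0 y = x /\ V s y.
  by have [V ? ?] := nW i; exists V.
pose c y : option I := unpickle (pr 2 y 0%N).
have fc : findep c.
  by apply: (@findep_comp _ _ unpickle (fun y => pr 2 y 0%N)); exact: findep_coord.
exists (fun s y => c y /\ forall i, c y = Some i ->
    pr 0 (pr 1 y) = pr 0 y /\ V i s (pr 1 y)).
  apply: closed_rel_and.
    apply: (@closed_rel_prop (fun y => is_true (isSome (c y)))).
    exact: (@findep_comp _ _ (fun o : option I => is_true (isSome o))).
  apply: closed_rel_forall => i; apply: closed_rel_imp.
    exact: (@findep_comp _ _ (fun o : option I => o = Some i)).
  apply: closed_rel_and; last by apply: closed_rel_ctn => //; exact: ctn_pr.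
  by apply: (@closed_rel_eq (pr 0 \o pr 1)); [apply: ctn_comp|]; exact: ctn_pr.
move=> s x; split=> [[i /VP[y [yx Vy]]]|[y [yx []]]].
  exists (join (fun n => match n with 0%N => x | 1%N => y | _ => fun=> pickle i end)).
  rewrite pr_join /c !pr_join/= pickleK; split=> //; split=> // _ [<-].
  by rewrite yx.
case: (c y) => // i _ /(_ i erefl)[e Vi]; exists i.
by apply/VP; exists (pr 1 y); rewrite e.
Qed.

Lemma souslin_rel_and W W' : souslin_rel W -> souslin_rel W' ->
  souslin_rel (fun s x => W s x /\ W' s x).
Proof.
move=> nW nW'; apply: (@souslin_rel_ext (fun s x => forall b, (if b then W else W') s x)).
  by move=> s x; split=> [H|[? ?] []//]; split; [exact: (H true)|exact: (H false)].
by apply: souslin_rel_forall => -[].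
Qed.

Lemma souslin_rel_or W W' : souslin_rel W -> souslin_rel W' ->
  souslin_rel (fun s x => W s x \/ W' s x).
Proof.
move=> nW nW'; apply: (@souslin_rel_ext (fun s x => exists b, (if b then W else W') s x)).
  by move=> s x; split=> [[[] ?]|[?|?]]; [left|right|exists true|exists false].
by apply: souslin_rel_exist => -[].
Qed.

(** A substitute for Borel relations in the pair (s, x): the class is closed under complements and
    countable unions, so a generating family suffices ([bisouslin_sigma]). *)
Definition bisouslin W := souslin_rel W /\ souslin_rel (fun s x => ~ W s x).

Lemma bisouslin_ext W W' : (forall s x, W s x <-> W' s x) -> bisouslin W -> bisouslin W'.
Proof.
move=> WW' [nW nW']; split; first exact: souslin_rel_ext nW.
by apply: souslin_rel_ext nW' => s x; rewrite WW'.
Qed.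

Lemma bisouslin_not W : bisouslin W -> bisouslin (fun s x => ~ W s x).
Proof.
move=> [nW nW']; split=> //; apply: souslin_rel_ext nW => s x.
by split=> [? /(_ _)|/contrapT].
Qed.

Lemma bisouslin_exist (I : countType) (W : I -> T -> baire -> Prop) :
  (forall i, bisouslin (W i)) -> bisouslin (fun s x => exists i, W i s x).
Proof.
move=> bW; split; first by apply: souslin_rel_exist => i; have [] := bW i.
apply: (@souslin_rel_ext (fun s x => forall i, ~ W i s x)).
  by move=> s x; split=> [H [i /H]//|H i Wi]; apply: H; exists i.
by apply: souslin_rel_forall => i; have [] := bW i.
Qed.

Lemma bisouslin_forall (I : countType) (W : I -> T -> baire -> Prop) :
  (forall i, bisouslin (W i)) -> bisouslin (fun s x => forall i, W i s x).
Proof.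
move=> bW; apply: (@bisouslin_ext (fun s x => ~ exists i, ~ W i s x)).
  move=> s x; split=> [H i|H [i]]; last exact.
  by apply: contrapT => nWi; apply: H; exists i.
by apply: bisouslin_not; apply: bisouslin_exist => i; exact: bisouslin_not.
Qed.

Lemma bisouslin_set (C : baire -> set T) : (forall x, measurable (C x)) ->
  findep C -> bisouslin (fun s x => C x s).
Proof.
move=> mC fC; split; first by apply/souslin_rel_closed/closed_rel_set.
apply/souslin_rel_closed/(@closed_rel_set (fun x => ~` C x)) => [x|]; first exact: measurableC.
exact: (@findep_comp _ _ setC).
Qed.

Lemma bisouslin_prop (C : baire -> Prop) : findep C -> bisouslin (fun _ x => C x).
Proof.
move=> fC; split; first by apply/souslin_rel_closed/closed_rel_prop.
by apply/souslin_rel_closed/(@closed_rel_prop (fun x => ~ C x)); exact: (@findep_comp _ _ not).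
Qed.

Lemma bisouslin_and W W' : bisouslin W -> bisouslin W' ->
  bisouslin (fun s x => W s x /\ W' s x).
Proof.
move=> bW bW'; apply: (@bisouslin_ext (fun s x => forall b, (if b then W else W') s x)).
  by move=> s x; split=> [H|[? ?] []//]; split; [exact: (H true)|exact: (H false)].
by apply: bisouslin_forall => -[].
Qed.

Lemma bisouslin_or W W' : bisouslin W -> bisouslin W' ->
  bisouslin (fun s x => W s x \/ W' s x).
Proof.
move=> bW bW'; apply: (@bisouslin_ext (fun s x => exists b, (if b then W else W') s x)).
  by move=> s x; split=> [[[] ?]|[?|?]]; [left|right|exists true|exists false].
by apply: bisouslin_exist => -[].
Qed.

Lemma bisouslin_ctn g W : ctn g -> bisouslin W -> bisouslin (fun s x => W s (g x)).
Proof. by move=> gc [nW nW']; split;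
  [exact: souslin_rel_ctn nW|exact: souslin_rel_ctn nW']. Qed.

Lemma bisouslin_sigma (Z : Type) (f : T -> baire -> Z) (G : set (set Z)) :
  (forall U, G U -> bisouslin (fun s x => U (f s x))) ->
  forall C, <<s G >> C -> bisouslin (fun s x => C (f s x)).
Proof.
move=> Gb; apply: (@smallest_sub _ (sigma_algebra setT) _
  [set C | bisouslin (fun s x => C (f s x))]) => //; split=> [|C /= bC|F /= bF].
- by apply: (@bisouslin_prop (fun=> False)); exists 0%N.
- by apply: bisouslin_ext (bisouslin_not bC) => s x; split=> [|[]].
- by apply: bisouslin_ext (bisouslin_exist bF) => s x; split=> [[i Fi]|[i _ Fi]]; exists i.
Qed.

Lemma measurable_exist (I : countType) (F : I -> set T) :
  (forall i, measurable (F i)) -> measurable [set s | exists i, F i s].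
Proof.
move=> mF; rewrite (_ : [set _ | _] =
    \bigcup_n (if unpickle n is Some i then F i else set0)); last first.
  apply/seteqP; split=> [s [i Fi]|s [n _]].
    by exists (pickle i) => //; rewrite pickleK.
  by case: unpickle => // i Fi; exists i.
by apply: bigcupT_measurable => n; case: unpickle.
Qed.

Lemma measurable_forall (I : countType) (F : I -> set T) :
  (forall i, measurable (F i)) -> measurable [set s | forall i, F i s].
Proof.
move=> mF; rewrite (_ : [set _ | _] = ~` [set s | exists i, (~` F i) s]).
  by apply/measurableC/measurable_exist => i; exact: measurableC.
apply/seteqP; split=> s /= H => [[i /(_ (H i))]//|i].
by apply: contrapT => nFi; apply: H; exists i.
Qed.

Lemma measurable_prop (C : Prop) : measurable [set _ : T | C].
Proof.
have [c|nc] := pselect C.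
  by rewrite (_ : [set _ | _] = setT)//; apply/seteqP; split.
by rewrite (_ : [set _ | _] = set0)//; apply/seteqP; split.
Qed.

Definition souslin E := souslin_rel (fun s _ => E s).

Lemma souslinP E : souslin E <->
  exists2 V, closed_rel V & forall s, E s <-> exists y, V s y.
Proof.
split=> [[V cV VP]|[V cV VP]].
  exists V => // s; split=> [/(VP s (fun=> 0%N))[y [_ Vy]]|[y Vy]]; first by exists y.
  by apply/(VP s (pr 0 y)); exists y.
exists (fun s y => V s (pr 1 y)); first by apply: closed_rel_ctn => //; exact: ctn_pr.
move=> s x; rewrite VP; split=> [[y Vy]|[y [_ Vy]]]; last by exists (pr 1 y).
by exists (join (fun i => if i == 0%N then x else y)); rewrite !pr_join.
Qed.

Lemma souslin_proj W : souslin_rel W -> souslin [set s | exists x, W s x].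
Proof.
move=> [V cV VP]; apply/souslinP; exists V => // s /=; split.
  by move=> [x /VP[y [_ Vy]]]; exists y.
by move=> [y Vy]; exists (pr 0 y); apply/VP; exists y.
Qed.

Lemma souslin_measurable E : measurable E -> souslin E.
Proof.
move=> mE; suff [] : bisouslin (fun s _ => E s) by [].
by apply: (@bisouslin_set (fun=> E)) => //; exists 0%N.
Qed.

(* [P] is antitone along prefixes, so that [P (mkseq y n)] decreases with [n]. *)
Lemma closed_rel_tree V : closed_rel V -> exists P : seq nat -> set T,
  [/\ forall t, measurable (P t), forall t n, P t `<=` P (take n t) &
      forall s y, V s y <-> forall n, P (mkseq y n) s].
Proof.
move=> [Q [mQ fQ VQ]].
have /choice[m mP] := fQ.
(* Only the conditions already decided by the prefix [t] are imposed, so the padding of [t] by zeros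
   does not affect them. *)
exists (fun t => \bigcap_(j in [set j | (m j <= size t)%N]) Q j (nth 0%N t)).
split=> [t|t n s Ps j /= mj|s y].
- exact: bigcap_measurableType.
- have mjt : (m j <= size t)%N.
    by apply: leq_trans mj _; rewrite size_take_min geq_minr.
  rewrite (mP j _ (nth 0%N t)); first exact: Ps.
  move=> i im; apply: nth_take.
  by move: (leq_trans im mj); rewrite size_take_min leq_min => /andP[].
- split=> [Vy n j|Vy].
    rewrite /= size_mkseq => mj.
    rewrite -(mP j y); first by move/VQ: Vy; apply.
    by apply: agree_le mj _; exact: agree_mkseq.
  apply/VQ => j; have /= := Vy (m j) j; rewrite size_mkseq => /(_ (leqnn _)).
  by rewrite -(mP j y)//; exact: agree_mkseq.
Qed.

Lemma souslin_tree E : souslin E -> exists P : seq nat -> set T,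
  [/\ forall t, measurable (P t), forall t n, P t `<=` P (take n t) &
      forall s, E s <-> exists y, forall n, P (mkseq y n) s].
Proof.
move=> /souslinP[V /closed_rel_tree[P [mP aP VP]] EV]; exists P; split=> // s.
by rewrite EV; split=> -[y Vy]; exists y; exact/VP.
Qed.

End souslin.

(** * Inverse images of Souslin sets *)

Section substitution.
Context d (T : measurableType d) d' (T' : measurableType d').

(** Condition [Q j] reads only a prefix of length [m j], so it splits into countably many
    implications, one per possible prefix [t]. In each of them the measurable set is fixed, and its
    inverse image under [k] is bisouslin by hypothesis. *)
Lemma souslin_rel_subst (k : T -> baire -> T') (E : set T') :
  (forall C, measurable C -> bisouslin (fun s x => C (k s x))) ->
  souslin E -> souslin_rel (fun s x => E (k s x)).
Proof.
move=> mk /souslinP[V [Q [mQ fQ VQ]] EV].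
have /choice[m mP] := fQ.
apply: (@souslin_rel_ext _ _ (fun s x => exists z, pr 0 z = x /\
   forall (p : nat * seq nat), p.2 <> mkseq (pr 1 z) (m p.1) \/
     Q p.1 (nth 0%N p.2) (k s (pr 0 z)))).
  move=> s x; rewrite EV; split=> [[z [<- H]]|[y /VQ Vy]].
    exists (pr 1 z); apply/VQ => j.
    have := H (j, mkseq (pr 1 z) (m j)) => /=; rewrite -(mP j (pr 1 z)).
      by case.
    exact: agree_mkseq.
  exists (join (fun i => if i == 0%N then x else y)); rewrite !pr_join/=.
  split=> // -[j t] /=.
  have [->|?] := pselect (t = mkseq y (m j)); last by left.
  by right; rewrite -(mP j y)//; exact: agree_mkseq.
apply: souslin_rel_exists; apply: souslin_rel_forall => -[j t] /=.
apply: souslin_rel_or.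
  suff [] : bisouslin (fun (_ : T) z => t <> mkseq (pr 1 z) (m j)) by [].
  apply: bisouslin_prop; apply: (@findep_comp _ _ (fun u => t <> u)).
  have [m' m'P] := ctn_agree (ctn_pr 1) (m j).
  exists m' => x y /m'P xy; apply/eq_in_map => i; rewrite mem_iota add0n => /andP[_].
  exact: xy.
by have [] := bisouslin_ctn (ctn_pr 0) (mk _ (mQ j (nth 0%N t))).
Qed.

End substitution.

(** * Coding of Polish spaces *)

(** Quantifying over every measurable [T] allows a code to serve as the parameter beside any base
    space. *)
Definition codable (X : topologicalType) := exists phi : baire -> X,
  (forall a, exists x, phi x = a) /\
  forall d (T : measurableType d) (C : set X), borel_set C ->
    bisouslin (fun (_ : T) x => C (phi x)).

Definition seq_base (X : topologicalType) (U : nat -> set X) :=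
  (forall n, open (U n)) /\
  forall V a, open V -> V a -> exists n, U n a /\ U n `<=` V.

Lemma natSinv_lt (R : realType) (e : R) : 0 < e -> exists n, n.+1%:R^-1 < e.
Proof.
move=> e0; exists (Num.bound e^-1).
rewrite invf_plt ?posrE//.
apply: (@lt_le_trans _ _ (Num.bound e^-1)%:R); last by rewrite ler_nat.
by apply: archi_boundP; rewrite invr_ge0 ltW.
Qed.

Section polish.
Context (R : realType) (X : completeMetricType R).
Hypothesis sepX : separable X.
Notation dist := (@mdist R X).

Lemma metric_ball_open (a : X) (e : R) : open (ball a e).
Proof.
rewrite openE => b /=; rewrite /interior ballEmdist/= => ab.
apply/nbhs_ballP; exists (e - dist a b); first by rewrite /= subr_gt0.
move=> c; rewrite !ballEmdist/= => bc.
by apply: le_lt_trans (metric_triangle _ b _) _; rewrite addrC -ltrBrDr.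
Qed.

Lemma dense_seq : exists dn : nat -> X,
  forall a (e : R), 0 < e -> exists n, dist (dn n) a < e.
Proof.
have [D /countable_injP[f fI] dD] := sepX.
pose g n := xget point [set a | D a /\ f a = n].
exists g => a e e0.
have [] := dD (ball a e).
- by exists a; exact: ballxx.
- exact: metric_ball_open.
move=> b [+ Db]; rewrite ballEmdist/= metric_sym => ab.
exists (f b); suff -> : g (f b) = b by [].
rewrite /g; case: xgetP => [c _ [Dc /fI]|/(_ b)[]//].
by apply; rewrite inE.
Qed.

Lemma separable_seq_base : exists U : nat -> set X, seq_base U.
Proof.
have [dn dnP] := dense_seq.
exists (fun k => if unpickle k is Some (i, n) then ball (dn i) (n.+1%:R^-1 : R)
  else set0); split=> [k|V a oV Va].
  case: unpickle => [[i n]|]; last exact: open0.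
  exact: metric_ball_open.
have /nbhs_ballP[e /= e0 eV] : nbhs a V by exact: open_nbhs_nbhs.
have [n ne] := @natSinv_lt R (e / 2) ltac:(by rewrite divr_gt0).
have [i ia] := @dnP a n.+1%:R^-1 ltac:(by []).
exists (pickle (i, n)); rewrite pickleK ballEmdist/=; split => // b /= ib.
apply: eV; rewrite ballEmdist/=.
apply: le_lt_trans (metric_triangle _ (dn i) _) _.
by rewrite (splitr e) ltrD// ?(lt_trans _ ne)// metric_sym.
Qed.

(** A sequence [x] codes [l] when the dense points [dn (x n)] approach [l] at the prescribed rate
    [dl n]. Sequences that code nothing are sent to [point]. *)
Lemma polish_codable : codable X.
Proof.
have [dn dnP] := dense_seq.
pose dl n : R := n.+1%:R^-1.
pose L (x : baire) := [set l | forall n, dist (dn (x n)) l <= dl n].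
have dl0 n : 0 < dl n by rewrite /dl.
have dlW m n : (n <= m)%N -> dl m <= dl n.
  by move=> nm; rewrite /dl lef_pV2 ?posrE// ler_nat ltnS.
(* A Cauchy condition with explicit rate: by completeness it characterises the codes ([FL]), and it
   involves only two terms of [x] at a time. *)
pose F (x : baire) := forall p : nat * nat,
  dist (dn (x p.1)) (dn (x p.2)) <= dl p.1 + dl p.2.
have FL x : F x <-> exists l, L x l.
  split=> [Fx|[l Ll] [n m] /=]; last first.
    apply: le_trans (metric_triangle _ l _) _.
    by rewrite lerD// metric_sym.
  pose u := fun n => dn (x n).
  have cu : cauchy (u @ \oo).
    apply: cauchy_exP => e e0.
    have [n ne] := @natSinv_lt R (e / 2) ltac:(by rewrite divr_gt0).
    exists (u n); exists n => //= m /= nm; rewrite ballEmdist/=.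
    apply: le_lt_trans (Fx (n, m)) _; rewrite /= (splitr e).
    by rewrite ltrD// (le_lt_trans _ ne)//; exact: dlW.
  have ul := @cauchy_cvg X (u @ \oo) _ cu; set l := lim _ in ul.
  exists l => n; apply/ler_addgt0Pr => e e0.
  have [k ke] := @natSinv_lt R (e / 2) ltac:(by rewrite divr_gt0).
  have [N _ uN] : (u @ \oo) (ball l (e / 2)).
    by apply: ul; apply: nbhsx_ballx; rewrite divr_gt0.
  pose m := maxn k N.
  have /uN : (N <= m)%N by rewrite leq_maxr.
  rewrite /= ballEmdist/= metric_sym => ml.
  apply: le_trans (metric_triangle _ (u m) _) _.
  apply: le_trans (lerD (Fx (n, m)) (ltW ml)) _.
  rewrite /= -addrA lerD2l [leRHS](splitr e) lerD2r.
  by apply: le_trans (ltW ke); apply: dlW; rewrite leq_maxl.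
pose phi x := xget point (L x).
have phiL x : F x -> L x (phi x).
  by move=> /FL; exact: xgetPex.
have L1 x l l' : L x l -> L x l' -> l = l'.
  move=> Ll Ll'; apply/mdist_positivity/eqP; rewrite eq_le mdist_ge0 andbT.
  apply/ler_addgt0Pr => e e0; rewrite add0r.
  have [n ne] := @natSinv_lt R (e / 2) ltac:(by rewrite divr_gt0).
  apply: le_trans (metric_triangle _ (dn (x n)) _) _.
  rewrite (splitr e) lerD//; last exact: le_trans (Ll' n) (ltW ne).
  by rewrite metric_sym; exact: le_trans (Ll n) (ltW ne).
exists phi; split=> [a|d T C].
  have /choice[x xP] n := @dnP a (dl n) (dl0 n).
  have Lx : L x a by move=> n; exact/ltW/xP.
  by exists x; apply: (L1 x) => //; apply: phiL; apply/FL; exists a.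
have bF : bisouslin (fun (_ : T) x => F x).
  apply: (@bisouslin_forall _ T _ (fun (p : nat * nat) _ x =>
    dist (dn (x p.1)) (dn (x p.2)) <= dl p.1 + dl p.2)) => p.
  apply: (@bisouslin_prop _ T (fun x => dist (dn (x p.1)) (dn (x p.2)) <= dl p.1 + dl p.2)).
  by exists (maxn p.1 p.2).+1 => x y xy; rewrite !xy// ltnS ?leq_maxl ?leq_maxr.
apply: (@bisouslin_sigma _ _ _ (fun=> phi)) => U oU.
(* The doubled radius puts the limit strictly inside the ball. Conversely such a ball lies within 3
   [dl n] of the limit, which explains [e / 3] below. *)
apply: (@bisouslin_ext _ _ (fun _ x =>
   (F x /\ exists n, ball (dn (x n)) (dl n + dl n) `<=` U) \/ (~ F x /\ U point))).
  move=> _ x; split=> [[[Fx [n nU]]|[nFx Up]]|].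
  - apply: nU; rewrite ballEmdist/=; apply: le_lt_trans (phiL x Fx n) _.
    by rewrite ltrDl.
  - rewrite /phi; case: xgetP => [l _ Ll|//].
    by exfalso; apply: nFx; apply/FL; exists l.
  - have [Fx Ux|nFx] := pselect (F x); last first.
      rewrite /phi; case: xgetP => [l _ Ll|_ ? ]; last by right.
      by exfalso; apply: nFx; apply/FL; exists l.
    left; split=> //.
    have /nbhs_ballP[e /= e0 eU] : nbhs (phi x) U by exact: open_nbhs_nbhs.
    have [n ne] := @natSinv_lt R (e / 3) ltac:(by rewrite divr_gt0).
    exists n => y; rewrite ballEmdist/= => ny; apply: eU; rewrite ballEmdist/=.
    apply: le_lt_trans (metric_triangle _ (dn (x n)) _) _.
    have := phiL x Fx n; rewrite metric_sym => h.
    have {}ne : dl n + dl n + dl n < e.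
      by move: (dl n) (ne : dl n < e / 3) => z; lra.
    by apply: lt_trans ne; rewrite -addrA; apply: ler_ltD.
apply: bisouslin_or; apply: bisouslin_and => //; last 2 first.
- exact: bisouslin_not.
- by apply: (@bisouslin_prop _ _ (fun=> U point)); exists 0%N.
apply: bisouslin_exist => n.
apply: (@bisouslin_prop _ _ (fun x => ball (dn (x n)) (dl n + dl n) `<=` U)).
by exists n.+1 => x y xy; rewrite xy.
Qed.

End polish.

Lemma set_type_open (X : topologicalType) (E : set X) (V : set (set_type E)) :
  open V <-> exists2 U : set X, open U & V = val @^-1` U.
Proof. by split=> [[U oU <-]|[U oU ->]]; exists U. Qed.

Lemma seq_base_sub (X : topologicalType) (E : set X) :
  (exists U : nat -> set X, seq_base U) ->
  exists U : nat -> set (set_type E), seq_base U.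
Proof.
move=> [U [oU UP]]; exists (fun n => val @^-1` U n); split=> [n|V a].
  by apply/set_type_open; exists (U n).
move=> /set_type_open[W oW ->] /= Wa.
by have [n [Ua UW]] := UP W _ oW Wa; exists n; split=> // b /UW.
Qed.

(** * Projections *)

Lemma seq_base_prod (X Y : topologicalType) (U : nat -> set X)
    (V : nat -> set Y) : seq_base U -> seq_base V ->
  seq_base (fun k => if unpickle k is Some (i, j) then U i `*` V j else set0).
Proof.
move=> [oU UP] [oV VP]; split=> [k|O [a b] oO Oab].
  case: unpickle => [[i j]|]; last exact: open0.
  rewrite openE => -[a b] [Ua Vb]; exists (U i, V j) => //=.
  by split; exact: open_nbhs_nbhs.
have [[A B] /= [nA nB] ABO] : nbhs (a, b) O by exact: open_nbhs_nbhs.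
move: nA nB; rewrite !nbhsE => -[A' [oA' A'a] A'A] [B' [oB' B'b] B'B].
have [i [Ua UA]] := UP _ _ oA' A'a; have [j [Vb VB]] := VP _ _ oB' B'b.
exists (pickle (i, j)); rewrite pickleK; split=> // -[c e] /= [Uc Ve].
by apply: ABO; split; [exact/A'A/UA|exact/B'B/VB].
Qed.

Lemma seq_base_bigcup (X : topologicalType) (U : nat -> set X) (V : set X) :
  seq_base U -> open V -> V = \bigcup_(n in [set n | U n `<=` V]) U n.
Proof.
move=> [_ UP] oV; apply/seteqP; split=> [a Va|a [n UV /UV//]].
by have [n [Ua UV]] := UP V a oV Va; exists n.
Qed.

(** * Borel maps of a point and a sequence *)

Section joint_coding.
Context d (T : measurableType d).

Definition joint_borel (Z : topologicalType) (f : T -> baire -> Z) :=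
  forall C, borel_set C -> bisouslin (fun s x => C (f s x)).

Lemma joint_borel_base (Z : topologicalType) (U : nat -> set Z)
    (f : T -> baire -> Z) : seq_base U ->
  (forall n, bisouslin (fun s x => U n (f s x))) -> joint_borel f.
Proof.
move=> bU Uf; apply: bisouslin_sigma => V oV.
rewrite (seq_base_bigcup bU oV).
apply: (@bisouslin_ext _ _ (fun s x => exists n, (U n `<=` V) /\ U n (f s x))).
  by move=> s x; split=> [[n [? ?]]|[n ? ?]]; exists n.
apply: bisouslin_exist => n; apply: bisouslin_and => //.
by apply: (@bisouslin_prop _ _ (fun=> U n `<=` V)); exists 0%N.
Qed.

(** Second countability is the point: an open set of the product is a countable union of basic
    rectangles, and a rectangle is tested one coordinate at a time. *)
Lemma joint_borel_pair (X Y : topologicalType) (U : nat -> set X) (V : nat -> set Y)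
    (f : T -> baire -> X) (g : T -> baire -> Y) :
  seq_base U -> seq_base V -> joint_borel f -> joint_borel g ->
  joint_borel (fun s x => (f s x, g s x)).
Proof.
move=> bU bV jf jg; apply: (joint_borel_base (seq_base_prod bU bV)) => n.
case: unpickle => [[i j]|]; last first.
  by apply: (@bisouslin_prop _ _ (fun=> False)); exists 0%N.
apply: bisouslin_and; [apply: jf|apply: jg]; apply: sub_gen_smallest.
  by have [+ _] := bU; apply.
by have [+ _] := bV; apply.
Qed.

(** A total retraction onto the subspace. The default value outside [E] is harmless because
    membership in the Borel set [E] can be tested separately. *)
Definition corestr (Z : topologicalType) (E : nonemptyBorel Z) (z : Z) :
    set_type E :=
  if pselect (carrier E z) is left Ez then exist _ z (mem_set Ez) else point.

Lemma corestrE (Z : topologicalType) (E : nonemptyBorel Z) (z : Z) :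
  carrier E z -> val (corestr E z) = z.
Proof. by rewrite /corestr; case: pselect. Qed.

Lemma corestr_val (Z : topologicalType) (E : nonemptyBorel Z) (k : set_type E) :
  corestr E (val k) = k.
Proof. by apply: val_inj; rewrite corestrE//; exact/set_mem/valP. Qed.

Lemma joint_borel_corestr (Z : topologicalType) (E : nonemptyBorel Z)
    (f : T -> baire -> Z) : joint_borel f -> joint_borel (fun s x => corestr E (f s x)).
Proof.
move=> jf; apply: bisouslin_sigma => V /set_type_open[W oW ->].
have bE : bisouslin (fun s x => carrier E (f s x)) by apply: jf; exact: carrier_borel.
apply: (@bisouslin_ext _ _ (fun s x => (carrier E (f s x) /\ W (f s x)) \/
   (~ carrier E (f s x) /\ W (val (point : set_type E))))).
  move=> s x; rewrite /corestr; case: pselect => [? | ?] /=; tauto.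
apply: bisouslin_or; apply: bisouslin_and => //.
- by apply: jf; exact: sub_gen_smallest.
- exact: bisouslin_not.
- apply: (@bisouslin_prop _ _ (fun=> W (val (point : set_type E)))); by exists 0%N.
Qed.

End joint_coding.

Lemma codable_sub (X : topologicalType) (E : nonemptyBorel X) :
  codable X -> codable (set_type E).
Proof.
move=> [phi [sphi bphi]]; exists (fun x => corestr E (phi x)); split=> [a|d T].
  by have [x xa] := sphi (val a); exists x; rewrite xa corestr_val.
apply: (@joint_borel_corestr _ _ _ _ (fun=> phi)); exact: bphi.
Qed.

Section projection.
Context (S A : ptopologicalType) (U : nat -> set S) (V : nat -> set A).
Hypotheses (bU : seq_base U) (bV : seq_base V).

Let jfst (phi : baire -> A) :
  (forall d (T : measurableType d) (C : set A), borel_set C ->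
    bisouslin (fun (_ : T) x => C (phi x))) ->
  joint_borel (fun (s : borel S) x => (s, phi x)).
Proof.
move=> bphi; apply: (@joint_borel_pair _ (borel S) S A U V (fun s _ => s) (fun=> phi)) => //.
  by move=> C bC; apply: (@bisouslin_set _ (borel S) (fun=> C)) => //; exists 0%N.
exact: bphi.
Qed.

Lemma souslin_fst (C : set (S * A)) : codable A -> borel_set C ->
  souslin (fst @` C : set (borel S)).
Proof.
move=> [phi [sphi /jfst jphi]] bC.
rewrite (_ : fst @` C = [set s | exists x, C (s, phi x)]).
  by apply: souslin_proj; have [] := jphi _ bC.
apply/seteqP; split=> [_ [[s a] Csa <-]|s [x Cx]]; last by exists (s, phi x).
by have [x xa] := sphi a; exists x; rewrite xa.
Qed.

(** Superlevel sets of a supremum over actions have this form. The action is replaced by a code [x],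
    and [E] is pulled back along the pair of a state and a code. *)
Lemma souslin_section (K : nonemptyBorel (S * A)%type) (E : set (borel K)) :
  codable A -> souslin E ->
  souslin ([set s | exists k : K, (val k).1 = s /\ E k] : set (borel S)).
Proof.
move=> [phi [sphi /jfst jphi]] sE.
pose kap s x := corestr K (s, phi x).
rewrite (_ : [set s | _] =
  [set s | exists x, carrier K (s, phi x) /\ E (kap s x)]).
  apply: souslin_proj; apply: souslin_rel_and.
    by have [] := jphi _ (carrier_borel K).
  by apply: souslin_rel_subst sE => C mC; exact: (joint_borel_corestr jphi).
apply/seteqP; split=> [_ [k [<- Ek]]|s [x [Kx Ex]]]; last first.
  by exists (kap s x); rewrite corestrE.
have [x xa] := sphi (val k).2; exists x.
rewrite /kap xa -surjective_pairing corestr_val; split=> //.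
exact/set_mem/valP.
Qed.

End projection.

(** * Perfect subtrees *)

Section cantor_scheme.
Variable P : seq nat -> Prop.
Hypothesis Panti : forall t n, P t -> P (take n t).

Let br (y : baire) := forall n, P (mkseq y n).
Let J := [set z | exists y, pr 0 y = z /\ br y].
Hypothesis Junc : ~ countable J.

Let idx (i : nat) : nat := pickle (0%N, i).
Let E t := [set z | exists y, [/\ pr 0 y = z, br y & mkseq y (size t) = t]].
Let big t := ~ countable (E t).

(* The cylinder of the points whose [pr 0]-coordinates are prescribed by [t]. *)
Definition cyl (t : seq nat) : set baire :=
  [set z | forall i, (pickle (0%N, i) < size t)%N ->
     z i = nth 0%N t (pickle (0%N, i))].

Let nth_prefix (s t : seq nat) i : prefix s t -> (i < size s)%N ->
  nth 0%N t i = nth 0%N s i.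
Proof.
rewrite prefixE => /eqP <- /[!size_take_min] /[!leq_min] /andP[? _].
by rewrite nth_take.
Qed.

Let mkseq_prefix (y : baire) m n : (m <= n)%N -> prefix (mkseq y m) (mkseq y n).
Proof.
move=> mn; rewrite prefixE size_mkseq /mkseq -map_take take_iota.
by move/minn_idPl : mn => ->.
Qed.

(** Otherwise all big extensions of [t] agree on the [pr 0]-coordinates and so determine a single
    point [zs]. Any other point of [E t] passes through one of the countably many nodes that are not
    big, so [E t] would be countable. *)
Let split_big t : big t -> exists c : bool -> seq nat,
  [/\ forall b, big (c b), forall b, prefix t (c b) &
   exists i, [/\ (idx i < size (c true))%N, (idx i < size (c false))%N &
     nth 0%N (c true) (idx i) <> nth 0%N (c false) (idx i)]].
Proof.
move=> bt; apply: contrapT => H; apply: bt.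
pose zs i := xget 0%N [set v | exists t', [/\ big t', prefix t t',
  (idx i < size t')%N & nth 0%N t' (idx i) = v]].
have zsP i t' : big t' -> prefix t t' -> (idx i < size t')%N ->
    nth 0%N t' (idx i) = zs i.
  move=> bt' tt' it'; rewrite /zs; case: xgetP => [v _ [t2 [bt2 tt2 it2 <-]]|].
    apply: contrapT => ne; apply: H.
    exists (fun b : bool => if b then t' else t2).
    by split; [case|case|exists i].
  by move=> /(_ (nth 0%N t' (idx i))) []; exists t'.
apply: (@sub_countable _ _ _ (\bigcup_(o in [set o |
    if o is Some t' then ~ big t' else True]) if o is Some t' then E t' else [set zs])).
  apply: subset_card_le => z [y [yz by_ yt]].
  have [->|zne] := pselect (z = zs); first by exists None.
  have [i zi] : exists i, z i <> zs i.
    apply: contrapT => Hz; apply: zne; apply/funext => i.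
    by apply: contrapT => ?; apply: Hz; exists i.
  pose N := maxn (size t) (idx i).+1.
  exists (Some (mkseq y N)) => /=; last by exists y; split => //; rewrite size_mkseq.
  move=> bN; apply: zi; rewrite -(zsP _ _ bN).
  - by rewrite nth_mkseq ?leq_max ?ltnSn ?orbT// -yz.
  - by rewrite -yt; apply: mkseq_prefix; rewrite leq_maxl.
  - by rewrite size_mkseq leq_max ltnSn orbT.
by apply: bigcup_countable => // -[t' /contrapT|_] //=; exact: countable1.
Qed.

Let split_fun : exists c : seq nat -> bool -> seq nat, forall t, big t ->
  [/\ forall b, big (c t b), forall b, prefix t (c t b) &
   exists i, [/\ (idx i < size (c t true))%N, (idx i < size (c t false))%N &
     nth 0%N (c t true) (idx i) <> nth 0%N (c t false) (idx i)]].
Proof.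
suff /choice[c cP] : forall t, exists c : bool -> seq nat, big t ->
  [/\ forall b, big (c b), forall b, prefix t (c b) &
   exists i, [/\ (idx i < size (c true))%N, (idx i < size (c false))%N &
     nth 0%N (c true) (idx i) <> nth 0%N (c false) (idx i)]] by exists c.
move=> t; have [/split_big[c cP]|nb] := pselect (big t); first by exists c.
by exists (fun=> [::]).
Qed.

(* Finite 0-1 sequences are stored with their last term first. *)
Definition revprefix (x : nat -> bool) n := iteri n (fun i => cons (x i)) [::].

Lemma size_revprefix x n : size (revprefix x n) = n.
Proof. by elim: n => //= n ->. Qed.

(** Repeated splitting gives a binary tree of big nodes. Siblings are separated on
    [pr 0]-coordinates, not merely as nodes, because a point of [J] remembers only that slice of its
    branch. *)
Lemma cantor_scheme : exists node : seq bool -> seq nat,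
  (forall x, exists2 z, J z & forall n, cyl (node (revprefix x n)) z) /\
  (forall s s' z, size s = size s' -> cyl (node s) z -> cyl (node s') z -> s = s').
Proof.
have [c cP] := split_fun.
pose node := foldr (fun b t => c t b) [::].
have bnode s : big (node s).
  elim: s => [/= cE|b s IH /=]; last by have [+ _ _] := cP _ IH; apply.
  apply: Junc; apply: sub_countable cE; apply: subset_card_le => z [y [yz yb]].
  by exists y.
have pnode b s : prefix (node s) (node (b :: s)).
  by have [_ + _] := cP _ (bnode s); apply.
have cylW t t' z : prefix t t' -> cyl t' z -> cyl t z.
  move=> tt' ct i it; rewrite ct ?(nth_prefix tt')//.
  by apply: leq_trans it _; exact: size_prefix.
exists node; split=> [x|].
  pose t n := node (revprefix x n).
  have tS n : prefix (t n) (t n.+1) by exact: pnode.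
  have tle m n : (m <= n)%N -> prefix (t m) (t n).
    elim: n => [|n IH]; first by rewrite leqn0 => /eqP ->; exact: prefix_refl.
    rewrite leq_eqVlt => /orP[/eqP ->|]; first exact: prefix_refl.
    by rewrite ltnS => /IH /prefix_trans; apply.
  (* Nodes grow strictly: if a child were no longer than its parent, the index where the children
     differ would lie inside the parent, where they coincide. *)
  have st n : (n <= size (t n))%N.
    elim: n => // n /leq_ltn_trans; apply.
    have [_ _ [i [i1 i0 ne]]] := cP _ (bnode (revprefix x n)).
    rewrite ltnNge; apply/negP => le.
    apply: ne.
    have [_ pc _] := cP _ (bnode (revprefix x n)).
    have eqsz : size (t n) = size (t n.+1).
      by apply/eqP; rewrite eqn_leq le andbT; exact/size_prefix/tS.
    have ilt : (idx i < size (t n))%N.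
      by rewrite eqsz /t /revprefix /= -/(revprefix x n); case: (x n).
    by rewrite (nth_prefix (pc true) ilt) (nth_prefix (pc false) ilt).
  pose y i := nth 0%N (t i.+1) i.
  have ty n : mkseq y (size (t n)) = t n.
    apply: (@eq_from_nth _ 0%N); rewrite size_mkseq// => i it.
    rewrite nth_mkseq// /y; have [le|le] := leqP n i.+1.
      by rewrite (nth_prefix (tle _ _ le)).
    by rewrite -(nth_prefix (tle _ _ (ltnW le)))//; exact: st.
  exists (pr 0 y); last first.
    move=> n i it; rewrite -/(t n) /pr in it *.
    by rewrite -(ty n) nth_mkseq.
  exists y; split=> // n.
  (* A big node lies on a genuine branch of [P], and that branch gives [P] at every prefix of the
     node. *)
  have [z [y' [_ by' y't]]] : exists z, E (t n) z.
    apply: contrapT => H; apply: (bnode (revprefix x n)).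
    rewrite (_ : E _ = set0)// -subset0 => z Ez; apply: H; by exists z.
  have := by' (size (t n)); rewrite y't => /(@Panti _ n).
  suff -> : take n (t n) = mkseq y n by [].
  by have := mkseq_prefix y (st n); rewrite ty prefixE size_mkseq => /eqP.
elim=> [|b s IH] [|b' s'] z //= [ss] cs cs'.
have e : s = s'.
  by apply: (IH _ z ss); [exact: cylW (pnode b s) cs|exact: cylW (pnode b' s') cs'].
rewrite -e in cs' *; congr cons.
have [_ _ [i [i1 i0]]] := cP _ (bnode s).
case: b b' cs cs' => -[] //= /(_ i) + /(_ i) => h1 h2; case.
  by rewrite -h1// -h2.
by rewrite -h1// -h2.
Qed.

End cantor_scheme.

(** * Analytic sets are Souslin sets *)

Section analytic_souslin.
Context (S : ptopologicalType) (U : nat -> set S).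
Hypotheses (bU : seq_base U) (codS : codable S).
Hypothesis sepU : forall a b, (forall n, U n a <-> U n b) -> a = b.

Let j (s : S) : baire := fun n => nat_of_bool `[< U n s >].

Let mU n : measurable (U n : set (borel S)).
Proof. by apply: sub_gen_smallest; have [+ _] := bU; apply. Qed.

Let mj n i : measurable ([set s | j s n = i] : set (borel S)).
Proof.
rewrite (_ : [set _ | _] = (U n `&` [set _ | i = 1%N]) `|`
    (~` U n `&` [set _ | i = 0%N])).
  by apply: measurableU; apply: measurableI => //;
    [exact: measurable_prop|exact: measurableC|exact: measurable_prop].
apply/seteqP; split=> s /=; rewrite /j; case: asboolP => Us /=.
- by left.
- by right.
- by case=> -[].
- by case=> -[].
Qed.

Lemma singleton_borel (s : S) : measurable ([set s] : set (borel S)).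
Proof.
rewrite (_ : [set s] = [set t | forall n, j t n = j s n]).
  by apply: measurable_forall => n; exact: mj.
apply/seteqP; split=> [t ->//|t jt]; apply: sepU => n.
have := jt n; rewrite /j.
by case: asboolP => h1; case: asboolP => h2.
Qed.

(** The base separates points, so [j] is injective and its range [J] is uncountable; [J] is Souslin
    through the coding of [S]. A Cantor scheme in [J] then yields a Borel map onto the 0-1
    sequences. *)
Let uncountable_bits : ~ countable [set: S] ->
  exists f : S -> nat -> bool,
    (forall n, measurable ([set s | f s n] : set (borel S))) /\
    forall x, exists s, f s = x.
Proof.
move=> unc; have [phi [sphi bphi]] := codS.
pose J : set baire := range j.
have sJ : @souslin_rel _ (borel S) (fun _ z => J z).
  pose W (_ : borel S) y := forall n,
    (pr 0 y n = 1%N /\ U n (phi (pr 1 y))) \/ (pr 0 y n = 0%N /\ ~ U n (phi (pr 1 y))).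
  apply: (@souslin_rel_ext _ _ (fun s z => exists y, pr 0 y = z /\ W s y)).
    move=> t z; split=> [[y [<- Wy]]|[s _ <-]].
      exists (phi (pr 1 y)) => //; apply/funext => n; rewrite /j.
      by case: (Wy n) => -[-> Us]; [rewrite asboolT|rewrite asboolF].
    have [x xs] := sphi s; exists (join (fun i => if i == 0%N then j s else x)).
    split=> [|n]; rewrite !pr_join//= xs /j.
    by case: asboolP => Us; [left|right].
  have bU1 n : bisouslin (fun (_ : borel S) y => U n (phi (pr 1 y))).
    apply: (@bisouslin_ctn _ (borel S) _ (fun _ x => U n (phi x)) (ctn_pr 1)).
    by apply: bphi; exact: mU.
  apply: souslin_rel_exists; apply: souslin_rel_forall => n.
  apply: souslin_rel_or; apply: souslin_rel_and.
  - have [] // : bisouslin (fun (_ : borel S) y => pr 0 y n = 1%N).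
    apply: (@bisouslin_prop _ _ (fun y => pr 0 y n = 1%N)).
    by apply: (@findep_comp _ _ (fun k : nat => k = 1%N)); exact: findep_coord.
  - by have [] := bU1 n.
  - have [] // : bisouslin (fun (_ : borel S) y => pr 0 y n = 0%N).
    apply: (@bisouslin_prop _ _ (fun y => pr 0 y n = 0%N)).
    by apply: (@findep_comp _ _ (fun k : nat => k = 0%N)); exact: findep_coord.
  - by have [] := bU1 n.
have [V /closed_rel_tree[P [_ aP VP]] JV] := sJ.
(* Membership in [J] does not involve the base point, so the tree may be read at any fixed one. *)
have [||node [nodeJ node1]] := @cantor_scheme (fun t => P t point).
- by move=> t n; exact: aP.
- move=> cJ; apply: unc.
  have {cJ} /countable_injP[g gI] : countable J.
    apply: sub_countable cJ; apply: subset_card_le => z /(JV point z)[y [yz Vy]].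
    by exists y; split=> //; exact/VP.
  apply/countable_injP; exists (g \o j) => a b _ _ /= /gI jab; apply: sepU => n.
  have : j a n = j b n by rewrite jab// inE; [exists a|exists b].
  by rewrite /j; case: asboolP => h1; case: asboolP => h2.
(* The head of [true :: q] is the bit of index [n]. Cylinders of one level are disjoint, so along a
   branch [x] the only possible [q] is [revprefix x n]. *)
pose f s n := `[< exists2 q, size q = n & cyl (node (true :: q)) (j s) >].
exists f; split=> [n|x].
  rewrite (_ : [set s | f s n] = [set s | exists q, size q = n /\
      forall i, (pickle (0%N, i : nat) < size (node (true :: q)))%N ->
         j s i = nth 0%N (node (true :: q)) (pickle (0%N, i))]); last first.
    apply/seteqP; split=> [s /asboolP[q]|s [q [? ?]]]; first by exists q.
    by apply/asboolP; exists q.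
  apply: measurable_exist => q.
  rewrite (_ : (fun s => _) = [set _ | size q = n] `&` [set s | forall i,
    (pickle (0%N, i : nat) < size (node (true :: q)))%N ->
         j s i = nth 0%N (node (true :: q)) (pickle (0%N, i))])//.
  apply: measurableI; first exact: measurable_prop.
  apply: measurable_forall => i; have [lt|nlt] := boolP (_ < _)%N.
    rewrite (_ : (fun s => _) =
      [set s | j s i = nth 0%N (node (true :: q)) (pickle (0%N, i))]).
      exact: mj.
    by apply/seteqP; split=> s //= /(_ isT).
  by rewrite (_ : (fun s => _) = setT)//; apply/seteqP; split.
have [z [y [yz Py]] cz] := nodeJ x.
have /(JV point z)[s _ jz] : exists y, pr 0 y = z /\ V point y.
  by exists y; split=> //; exact/VP.
exists s; apply/funext => n; rewrite /f jz.
apply/asboolP/idP => [[q qn cq]|xn].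
  have := node1 _ _ _ _ cq (cz n.+1).
  by rewrite /= size_revprefix qn => /(_ erefl)[<-].
exists (revprefix x n); first exact: size_revprefix.
by have := cz n.+1; rewrite /revprefix /= xn.
Qed.

(** The bits at pairs (n, m) are read as the graph of a function: [psi s n] is the only [m] whose
    bit is set, and 0 if there is no such [m]. Every sequence is reached through its own graph. *)
Lemma uncountable_baire : ~ countable [set: S] ->
  exists psi : S -> baire,
    (forall n i, measurable ([set s | psi s n = i] : set (borel S))) /\
    forall y, exists s, psi s = y.
Proof.
move=> /uncountable_bits[f [mf sf]].
pose A s (n m : nat) := f s (pickle (n, m)) /\
  forall m' : nat, f s (pickle (n, m')) -> m' = m.
have mA n m : measurable ([set s | A s n m] : set (borel S)).
  apply: measurableI; first exact: mf.
  apply: measurable_forall => m'.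
  rewrite (_ : (fun s => _) = ~` [set s | f s (pickle (n, m'))] `|` [set _ | m' = m]).
    apply: measurableU; last exact: measurable_prop.
    by apply: measurableC; exact: mf.
  apply/seteqP; split=> s /=; last by case=> [nf /nf|->].
  by move=> H; have [/H|/negP] := boolP (f s (pickle (n, m'))); [right|left].
exists (fun s n => xget 0%N [set m | A s n m]); split=> [n i|y].
  rewrite (_ : [set _ | _] = [set s | A s n i] `|`
     ([set _ | i = 0%N] `&` ~` [set s | exists m, A s n m])).
    apply: (@measurableU _ (borel S)); first exact: mA.
    apply: (@measurableI _ (borel S)); first exact: (@measurable_prop _ (borel S)).
    by apply: (@measurableC _ (borel S));
      exact: (@measurable_exist _ (borel S) _ (fun m s => A s n m) (mA n)).
  apply/seteqP; split=> s /=.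
    by case: xgetP => [m -> Am <-|H <-]; [left|right; split=> // -[m /H]].
  case: xgetP => [m -> [Am mU'] [[Ai _]|[_ []]]|H [/H//|[->//]]].
    by rewrite (mU' _ Ai).
  by eexists; split; [exact: Am|exact: mU'].
have [s fs] := sf (fun k => if unpickle k is Some (n, m) then y n == m else false).
exists s; apply/funext => n; apply: xget_unique.
  by rewrite /= /A fs; split=> [|m']; rewrite pickleK// => /eqP.
by move=> m [_ /(_ (y n))]; rewrite fs pickleK eqxx => /(_ isT).
Qed.

Let borel_preimage (Z Z' : topologicalType) (f : Z -> Z') C :
  continuous f -> borel_set C -> borel_set (f @^-1` C).
Proof.
move=> fc; apply: (@smallest_sub _ (sigma_algebra setT) _
  [set C | borel_set (f @^-1` C)]) => //; last first.
  by move=> V oV; apply: sub_gen_smallest; apply: open_comp => // ? _; exact: fc.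
have [b0 bC bU'] := smallest_sigma_algebra [set: Z] open.
by split=> [|D bD|F bF]; rewrite /= ?preimage_set0//;
  [exact: bC|exact: bU'].
Qed.

(** The second factor [S] must carry the Baire parameter, which it does through [psi]. A countable
    [S] admits no such map, but there every subset is Borel. *)
Lemma souslin_analytic (E : set S) :
  souslin (E : set (borel S)) -> analytic E.
Proof.
have [cS _|/uncountable_baire[psi [mpsi spsi]]] := pselect (countable [set: S]).
  exists (fst @^-1` E); last first.
    by apply/seteqP; split=> [s Es|_ [[s t] Es <-]//]; exists (s, s).
  apply: borel_preimage; first by move=> x; exact: cvg_fst.
  apply: (@countable_measurable _ (borel S)); first exact: singleton_borel.
  by apply: sub_countable cS; exact: subset_card_le.
move=> /souslinP[V [Q [mQ fQ VQ]] EV].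
have /choice[m mP] := fQ.
exists [set p : S * S | V p.1 (psi p.2)]; last first.
  apply/seteqP; split=> [s /EV[y Vy]|_ [[s t] Vst <-]]; last by apply/EV; exists (psi t).
  by have [t ty] := spsi y; exists (s, t) => //=; rewrite ty.
pose SS := borel (S * S)%type.
(* Splitting over the prefix [t] fixes the set [Q i] and leaves a Borel condition on each
   coordinate. *)
rewrite (_ : [set _ | _] = [set p | forall i, exists t,
    Q i (nth 0%N t) p.1 /\ mkseq (psi p.2) (m i) = t]); last first.
  apply/seteqP; split=> [[s t] /= /VQ H i|[s t] /= H].
    exists (mkseq (psi t) (m i)); split=> //.
    by rewrite -(mP i (psi t))//; exact: agree_mkseq.
  apply/VQ => i; have [u [+ tu]] := H i.
  by rewrite -tu -(mP i (psi t))//; exact: agree_mkseq.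
apply: (@measurable_forall _ SS) => i; apply: (@measurable_exist _ SS) => t.
apply: (@measurableI _ SS).
  by apply: (@borel_preimage _ _ fst); [by move=> x; exact: cvg_fst|exact: mQ].
apply: (@borel_preimage _ _ snd (fun s => mkseq (psi s) (m i) = t)).
  by move=> x; exact: cvg_snd.
rewrite (_ : (fun s => _) = [set s | size t = m i /\
    forall k, (k < m i)%N -> psi s k = nth 0%N t k]); last first.
  apply/seteqP; split=> [s st|s [st H]].
    by split=> [|k ki]; rewrite -st ?size_mkseq// nth_mkseq.
  apply: (@eq_from_nth _ 0%N); rewrite size_mkseq// => k ki.
  by rewrite nth_mkseq// H.
apply: (@measurableI _ (borel S)); first exact: (@measurable_prop _ (borel S)).
apply: (@measurable_forall _ (borel S)) => k.
have [ki|nki] := boolP (k < m i)%N.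
  rewrite (_ : (fun s => _) = [set s | psi s k = nth 0%N t k]); first exact: mpsi.
  by apply/seteqP; split=> s /= => [/(_ isT)|].
rewrite (_ : (fun s => _) = setT); first exact: (@measurableT _ (borel S)).
by apply/seteqP; split.
Qed.

Lemma analyticP (E : set S) : analytic E <-> souslin (E : set (borel S)).
Proof.
split; last exact: souslin_analytic.
by move=> [C bC ->]; exact: (souslin_fst bU bU).
Qed.

End analytic_souslin.

(** * Capacity *)

Section outer.
Local Open Scope ereal_scope.
Context d (T : measurableType d) (R : realType) (m : {measure set T -> \bar R}).
Hypothesis m1 : m setT = 1.

Let os : set T -> \bar R := mu_ext m.

Let os_ge0 E : 0 <= os E. Proof. exact: outer_measure_ge0. Qed.

Let le_os E F : E `<=` F -> os E <= os F.
Proof. exact: le_outer_measure. Qed.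

Let os_meas E : measurable E -> os E = m E.
Proof. exact: measurable_mu_extE. Qed.

Let os_le1 E : os E <= 1.
Proof. by rewrite -m1 -os_meas//; exact: le_os. Qed.

Let os_fin E : os E \is a fin_num.
Proof. by rewrite ge0_fin_numE// (le_lt_trans (os_le1 E))// ltry. Qed.

Lemma outer_hull E : exists H, [/\ measurable H, E `<=` H & m H = os E].
Proof.
have h n : exists H, [/\ measurable H, E `<=` H & m H <= os E + (n.+1%:R^-1)%:E].
  have e0 : (0 < n.+1%:R^-1 :> R)%R by [].
  have [_ [A [mA EA] <-] lt] := lb_ereal_inf_adherent e0 (os_fin E).
  exists (\bigcup_i A i); split=> //; first exact: bigcupT_measurable.
  apply: le_trans (ltW lt); apply: measure_sigma_subadditive => //.
  exact: bigcupT_measurable.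
have /choice[H /all_and3[mH EH Hle]] := h.
exists (\bigcap_n H n); have mI : measurable (\bigcap_n H n) by exact: bigcapT_measurable.
split=> //; first by move=> s Es n _; exact: EH.
apply/eqP; rewrite eq_le; apply/andP; split; last first.
  by rewrite -(os_meas mI); apply: le_os => s Es n _; exact: EH.
apply/lee_addgt0Pr => e e0.
have [n ne] := natSinv_lt e0.
apply: le_trans (_ : m (H n) <= _).
  by apply: le_measure; rewrite ?inE//; exact: bigcap_inf.
by apply: le_trans (Hle n) _; rewrite leeD2l// lee_fin ltW.
Qed.

(** Measurable hulls [F n] need not increase, but the tail intersections [G n] do. They still lie
    between [E n] and [F n], so continuity of the measure applies to them. *)
Lemma outer_continuity (E : nat -> set T) c :
  nondecreasing_seq E -> c < os (\bigcup_n E n) -> exists n, c < os (E n).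
Proof.
move=> ndE cE; apply: contrapT => H.
have leEc n : os (E n) <= c.
  by rewrite leNgt; apply/negP => ?; apply: H; exists n.
have /choice[F /all_and3[mF EF Fos]] := fun n => outer_hull (E n).
pose G n := \bigcap_(k in [set k | (n <= k)%N]) F k.
have mG n : measurable (G n) by exact: bigcap_measurableType.
have EG n : E n `<=` G n.
  move=> s Es k /= nk; apply: EF; have /subsetPset := ndE _ _ nk; exact.
have ndG : nondecreasing_seq G.
  move=> i j ij; apply/subsetPset => s Gs k /= jk; apply: Gs.
  exact: leq_trans jk.
have cvG := @nondecreasing_cvg_mu _ _ _ m _ mG (bigcupT_measurable _ mG) ndG.
suff : m (\bigcup_n G n) <= c.
  rewrite leNgt => /negP; apply; apply: lt_le_trans cE _.
  rewrite -os_meas; last exact: bigcupT_measurable.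
  by apply: le_os; apply: subset_bigcup => n _; exact: EG.
rewrite -(cvg_lim _ cvG)//; apply: lime_le; first by apply/cvg_ex; eexists; exact: cvG.
apply: nearW => n; apply: le_trans (leEc n); rewrite -Fos.
by apply: le_measure; rewrite ?inE//; apply: bigcap_inf => /=.
Qed.

End outer.

Section capacity.
Context d (T : measurableType d) (P : seq nat -> set T).
Hypothesis mP : forall t, measurable (P t).
Hypothesis aP : forall t n, P t `<=` P (take n t).

Let E := [set s | exists y, forall n, P (mkseq y n) s].

(** A finite union of sets [P t']; for [t] the prefix of length n of [z] it is the set [G_n(z)] of
    the overview. *)
Definition below (t : seq nat) : set T := [set s | exists t',
  (size t' = size t /\ forall i, (nth 0%N t' i <= nth 0%N t i)%N) /\ P t' s].

Lemma measurable_below t : measurable (below t).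
Proof.
apply: (@measurable_exist _ T) => t'.
by apply: measurableI => //; exact: measurable_prop.
Qed.

Let nth_mkseq0 (y : baire) n i : nth 0%N (mkseq y n) i = if (i < n)%N then y i else 0%N.
Proof.
by case: ltnP => ni; [rewrite nth_mkseq|rewrite nth_default ?size_mkseq].
Qed.

Lemma below_anti (z : baire) n k : (n <= k)%N ->
  below (mkseq z k) `<=` below (mkseq z n).
Proof.
move=> nk s [t [[st tle] Pt]]; exists (take n t); split; last exact: aP.
rewrite size_take_min st !size_mkseq; split; first exact/minn_idPl.
move=> i; rewrite nth_mkseq0; case: ltnP => ni.
  by rewrite nth_take//; have := tle i; rewrite nth_mkseq0 (leq_trans ni nk).
by rewrite nth_default// size_take_min geq_min ni.
Qed.

(* Koenig's lemma: the sequences below [z] form a finitely branching tree. *)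
Lemma below_branch (z : baire) s :
  (forall n, below (mkseq z n) s) -> E s.
Proof.
move=> Bs.
(* Good nodes have extensions of every length under [z]; the branch is built by staying among
   them. *)
pose good (t : seq nat) := forall n, (size t <= n)%N -> exists t', [/\ size t' = n,
  prefix t t', forall i, (nth 0%N t' i <= nth 0%N (mkseq z n) i)%N & P t' s].
have good0 : good [::].
  move=> n _; have [t' [[st tle] Pt]] := Bs n; exists t'.
  by split=> //; [rewrite st size_mkseq|exact: prefix0s].
have goodS t : good t -> exists k, good (rcons t k).
  move=> gt; apply: contrapT => /forallNP ng.
  have /choice[n nP] k : exists n, (size t < n)%N /\ ~ exists t', [/\ size t' = n,
      prefix (rcons t k) t',
      forall i, (nth 0%N t' i <= nth 0%N (mkseq z n) i)%N & P t' s].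
    have := ng k; move=> /existsNP[n /not_implyP[]]; rewrite size_rcons.
    by exists n.
  (* Each child [k] fails at some level [n k]. Past the maximum over the finitely many children
     allowed by [z] all have failed, yet [t] still has an extension there. *)
  pose N := \max_(k < (z (size t)).+1) n k.
  pose N' := maxn N (size t).+1.
  have [|t' [st' pt' tle Pt']] := gt N'.
    by rewrite leq_max (leqnSn _) orbT.
  have szt : (size t < size t')%N by rewrite st' leq_max leqnn orbT.
  pose k := nth 0%N t' (size t).
  have kz : (k < (z (size t)).+1)%N.
    have := tle (size t); rewrite nth_mkseq0 -st' szt; exact.
  have nN : (n k <= N')%N.
    rewrite leq_max; apply/orP; left.
    exact: (@leq_bigmax _ (fun i : 'I__ => n i) (Ordinal kz)).
  have [ltn nex] := nP k; apply: nex; exists (take (n k) t'); split.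
  - by rewrite size_take_min st'; exact/minn_idPl.
  - rewrite prefixE size_rcons take_takel//.
    rewrite (take_nth 0%N szt) -/k.
    by move: pt'; rewrite prefixE => /eqP ->.
  - move=> i; rewrite nth_mkseq0; case: ltnP => ni.
      by rewrite nth_take//; have := tle i; rewrite nth_mkseq0 (leq_trans ni nN).
    by rewrite nth_default// size_take_min geq_min ni.
  - exact: aP.
have /choice[k kP] : forall t, exists k, good t -> good (rcons t k).
  move=> t; have [/goodS[k ?]|?] := pselect (good t); first by exists k.
  by exists 0%N.
pose t n := iter n (fun t => rcons t (k t)) [::].
pose y n := k (t n).
have ty n : mkseq y n = t n by elim: n => // n IH; rewrite mkseqS IH.
exists y => n; rewrite ty.
have /(_ n)[|t' [st' pt' _ Pt']] : good (t n) by elim: n => //= n; exact: kP.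
  by rewrite -ty size_mkseq.
suff <- : t' = t n by [].
by move: pt'; rewrite prefixE -ty size_mkseq -{1}st' take_size => /eqP.
Qed.

Context (R : realType) (m : {measure set T -> \bar R}).
Hypothesis m1 : m setT = 1%E.

(** The witness is bounded by [t] on its first terms and free afterwards. Such sets are again
    projections, which is why the outer measure is used on them. *)
Let EL (t : seq nat) := [set s | exists y : baire,
  (forall i, (i < size t)%N -> (y i <= nth 0%N t i)%N) /\ forall n, P (mkseq y n) s].

Let EL_rcons t : EL t = \bigcup_k EL (rcons t k).
Proof.
apply/seteqP; split=> [s [y [yt Py]]|s [k _ [y [yt Py]]]].
  exists (y (size t)) => //; exists y; split=> // i; rewrite size_rcons ltnS nth_rcons.
  by case: ltngtP => // [it _|->//]; exact: yt.
exists y; split=> // i it; have := yt i; rewrite size_rcons nth_rcons it; apply.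
exact: ltnW.
Qed.

(** [EL t] is the increasing union of the sets [EL (rcons t k)], so continuity of the outer measure
    chooses the bounds [z n] one by one without dropping to [c]. At each stage [EL] is contained in
    [below]. *)
Lemma capacity_branch (c : \bar R) : (c < mu_ext m E)%E ->
  exists z : baire, forall n, (c < m (below (mkseq z n)))%E.
Proof.
move=> cE.
have /choice[k kP] : forall t, exists k, (c < mu_ext m (EL t))%E ->
    (c < mu_ext m (EL (rcons t k)))%E.
  move=> t; have [|/negP] := boolP (c < mu_ext m (EL t))%E; last by exists 0%N.
  rewrite EL_rcons => /(outer_continuity m1)[|k ck]; last by exists k.
  move=> i j ij; apply/subsetPset => s [y [yt Py]]; exists y; split=> // l.
  rewrite size_rcons => lt; have := yt l; rewrite size_rcons => /(_ lt) /leq_trans; apply.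
  by rewrite !nth_rcons; case: (ltngtP l (size t)).
pose t n := iter n (fun t => rcons t (k t)) [::].
pose z n := k (t n).
have tz n : mkseq z n = t n by elim: n => // n IH; rewrite mkseqS IH.
exists z => n; rewrite tz.
have ct : (c < mu_ext m (EL (t n)))%E.
  elim: n => [|n IH]; last exact: kP.
  rewrite (_ : EL _ = E)//; apply/seteqP; split=> [s [y [_ Py]]|s [y Py]]; exists y => //.
apply: lt_le_trans ct _; rewrite -(measurable_mu_extE m (measurable_below _)).
apply: le_outer_measure => s [y [yt Py]]; exists (mkseq y (size (t n))).
rewrite size_mkseq; split; last exact: Py.
by split=> // i; rewrite nth_mkseq0; case: ltnP => // /yt.
Qed.

(** The sets [below (mkseq z n)] decrease, and their intersection lies in [E] by [below_branch]; it
    is the required measurable [D]. *)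
Lemma capacity_kernel (z : baire) (c : \bar R) :
  (forall n, (c <= m (below (mkseq z n)))%E) ->
  exists D, [/\ measurable D, D `<=` E & (c <= m D)%E].
Proof.
move=> cz; pose B n := below (mkseq z n).
have mB n : measurable (B n) by exact: measurable_below.
exists (\bigcap_n B n); split; first exact: bigcapT_measurable.
  by move=> s Bs; apply: (@below_branch z) => n; exact: Bs.
have niB : nonincreasing_seq B.
  by move=> i j ij; apply/subsetPset; exact: below_anti.
have fin : (m (B 0%N) < +oo)%E.
  apply: le_lt_trans (_ : 1 < _)%E; last exact: ltry.
  by rewrite -m1; apply: le_measure; rewrite ?inE.
have cv := nonincreasing_cvg_mu fin mB (bigcapT_measurable mB) niB.
rewrite -(cvg_lim _ cv)//; apply: lime_ge; first by apply/cvg_ex; eexists; exact: cv.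
exact: nearW.
Qed.

End capacity.

(** * Universal measurability *)

Section universal_measurability.
Context d (T : measurableType d) (R : realType) (m : {measure set T -> \bar R}).
Hypothesis m1 : m setT = 1%E.
Local Open Scope ereal_scope.

Lemma souslin_kernel_set (E : set T) : souslin E ->
  exists D, [/\ measurable D, D `<=` E & m D = mu_ext m E].
Proof.
move=> /souslin_tree[P [mP aP EP]].
have -> : E = [set s | exists y, forall n, P (mkseq y n) s].
  by apply/seteqP; split=> s /EP.
set F := [set s | _].
have le1 : mu_ext m F <= 1 by rewrite -m1 -(measurable_mu_extE m)//; exact: le_outer_measure.
have fin : mu_ext m F \is a fin_num.
  by rewrite ge0_fin_numE ?outer_measure_ge0// (le_lt_trans le1)// ltry.
have h n : exists D, [/\ measurable D, D `<=` F & mu_ext m F - (n.+1%:R^-1)%:E <= m D].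
  have [|z zP] := @capacity_branch _ _ _ mP _ m m1 (mu_ext m F - (n.+1%:R^-1)%:E).
    by rewrite lteBlDr// lteDl// lte_fin.
  by apply: (capacity_kernel mP aP m1 (z := z)) => k; exact/ltW/zP.
have /choice[D /all_and3[mD DF Dm]] := h.
have mU : measurable (\bigcup_n D n) by exact: bigcupT_measurable.
have UF : \bigcup_n D n `<=` F by move=> s [n _ /DF].
exists (\bigcup_n D n); split=> //.
apply/eqP; rewrite eq_le -{1}(measurable_mu_extE m)// le_outer_measure//=.
apply/lee_addgt0Pr => e e0; have [n ne] := natSinv_lt e0.
rewrite -leeBlDr//; apply: le_trans (_ : m (D n) <= _).
  by apply: le_trans (Dm n); rewrite leeB// lee_fin ltW.
by apply: le_measure; rewrite ?inE//; exact: bigcup_sup.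
Qed.

(** A measurable kernel [D] and a measurable hull [H] of [E] have the same finite measure, so [E]
    differs from [D] by a part of the null set [H] minus [D]. *)
Lemma souslin_caratheodory (E : set T) : souslin E ->
  caratheodory_measurable (mu_ext m) E.
Proof.
move=> /souslin_kernel_set[D [mD DE Dm]].
have [H [mH EH Hm]] := outer_hull m1 E.
rewrite -(setUidr DE) -[E]/(E) -(setDUK DE) setUA setUid.
apply: caratheodory_measurable_setU.
  exact: caratheodory_measurable_mu_ext.
have N0 : mu_ext m (E `\` D) = 0.
  apply/eqP; rewrite eq_le outer_measure_ge0 andbT.
  apply: le_trans (_ : mu_ext m (H `\` D) <= _).
    by apply: le_outer_measure; exact: setSD.
  rewrite measurable_mu_extE; last exact: measurableD.
  have DH : D `<=` H by exact: subset_trans EH.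
  have finD : m D < +oo.
    rewrite (le_lt_trans (_ : _ <= 1))// ?ltry// -m1.
    by apply: le_measure; rewrite ?inE.
  have HD : m H = m D by rewrite Hm Dm.
  have finH : m H < +oo by rewrite HD.
  have e : m (H `\` D) = m H - m D.
    by have := measureD mH mD finH; rewrite (setIidr DH).
  by rewrite e HD subee// ge0_fin_numE.
apply: le_caratheodory_measurable => X.
rewrite [X in X + _](_ : _ = 0) ?add0e; first exact: le_outer_measure.
apply/eqP; rewrite eq_le outer_measure_ge0 andbT -N0.
exact: le_outer_measure.
Qed.

End universal_measurability.

(** [capacity_branch] gives one inclusion and [capacity_kernel] the other. The margin 1/(i+1) is
    there because strict bounds by [c] at every level would only leave [c <=] for the
    intersection. *)
Lemma souslin_kernel d (T : measurableType d) d' (T' : measurableType d')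
    (R : realType) (q : R.-pker T' ~> T) (E : set T) (c : R) :
  souslin E -> souslin [set k | (c%:E < mu_ext (q k) E)%E].
Proof.
move=> /souslin_tree[P [mP aP EP]].
have q1 k : q k setT = 1%E by exact: prob_kernel.
rewrite (_ : [set k | _] = [set k | exists z i, forall n,
    ((c + i.+1%:R^-1)%:E <= q k (below P (mkseq z n)))%E]).
  apply: souslin_proj; apply: souslin_rel_exist => i; apply: souslin_rel_closed.
  apply: closed_rel_forall => n.
  apply: (@closed_rel_set _ _ (fun z => [set k | ((c + i.+1%:R^-1)%:E <=
    q k (below P (mkseq z n)))%E])) => [z|].
    rewrite -[X in measurable X]setTI -preimage_itvcy.
    have mq : measurable_fun setT ((fun k => q k (below P (mkseq z n))) : T' -> \bar R).
      by apply: measurable_kernel; exact: measurable_below.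
    by apply: mq => //; exact: emeasurable_itv.
  exists n => y z yz.
  suff -> : mkseq y n = mkseq z n by [].
  by apply/eq_in_map => l; rewrite mem_iota add0n => /andP[_]; exact: yz.
set F := [set s : T | exists y, forall n, P (mkseq y n) s].
have -> : E = F by apply/seteqP; split=> s /EP.
apply/seteqP; split=> k /= [].
- move=> cF.
  have fin : mu_ext (q k) F \is a fin_num.
    rewrite ge0_fin_numE ?outer_measure_ge0//.
    apply: (@le_lt_trans _ _ 1%E); last exact: ltry.
    by rewrite -(q1 k) -(measurable_mu_extE (q k))//; exact: le_outer_measure.
  have [i ic] : exists i, c + i.+1%:R^-1 < fine (mu_ext (q k) F).
    have [|i ic] := @natSinv_lt R (fine (mu_ext (q k) F) - c).
      by rewrite subr_gt0 -lte_fin fineK.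
    by exists i; rewrite addrC -ltrBrDr.
  have [|z zP] := @capacity_branch _ _ _ mP _ (q k) (q1 k) (c + i.+1%:R^-1)%:E.
    by rewrite -(fineK fin) lte_fin.
  by exists z, i => n; exact/ltW/zP.
- move=> z [i /(capacity_kernel mP aP (q1 k))[D [mD DF cD]]].
  apply: (@lt_le_trans _ _ (c + i.+1%:R^-1)%:E).
    by rewrite lte_fin ltrDl.
  apply: le_trans cD _; rewrite -(measurable_mu_extE (q k))//.
  exact: le_outer_measure.
Qed.

(** * Upper semianalytic functions in Souslin form *)

Definition upper_souslin (R : realType) d (T : measurableType d) (f : T -> R) :=
  forall c, souslin [set s | c < f s].

Lemma ratr_between (R : realType) (a b : R) : a < b ->
  exists x : rat, a < ratr x < b.
Proof. by move=> /rat_in_itvoo[x]; rewrite in_itv/=; exists x. Qed.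

Lemma upper_souslinD (R : realType) d (T : measurableType d) (f g : T -> R) :
  upper_souslin f -> upper_souslin g -> upper_souslin (fun s => f s + g s).
Proof.
move=> uf ug c.
apply: (@souslin_rel_ext _ _ (fun s _ => exists x : rat, ratr x < f s /\ c - ratr x < g s)).
  move=> s _ /=; split=> [[x [xf xg]]|].
    by rewrite -(subrK (ratr x) c) addrC ltrD.
  rewrite -ltrBlDr => /ratr_between[x /andP[cx xf]]; exists x; split=> //.
  by rewrite ltrBlDr addrC -ltrBlDr.
apply: souslin_rel_exist => x; apply: souslin_rel_and; [exact: uf|exact: ug].
Qed.

Lemma upper_souslin_sum (R : realType) d (T : measurableType d) (f : nat -> T -> R) N :
  (forall i, upper_souslin (f i)) -> upper_souslin (fun s => \sum_(i < N) f i s).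
Proof.
move=> uf; elim: N => [c|N IH].
  apply: (@souslin_rel_ext _ _ (fun s _ => (c < 0))).
    by move=> s _ /=; rewrite big_ord0.
  suff [] : bisouslin (fun (_ : T) (_ : baire) => is_true (c < 0)) by [].
  by apply: (@bisouslin_prop _ _ (fun=> is_true (c < 0))); exists 0%N.
move=> c; apply: souslin_rel_ext (upper_souslinD IH (uf N) c) => s _ /=.
by rewrite big_ord_recr.
Qed.

(** * Integrals *)

Section probability_integral.
Context d (T : measurableType d) (R : realType) (mu : {measure set T -> \bar R}).
Hypothesis mu1 : mu setT = 1%E.

Lemma bounded_integrable (f : T -> R) (M : R) : measurable_fun setT f ->
  (forall s, `|f s| <= M) -> mu.-integrable setT (EFin \o f).
Proof.
move=> mf fM; apply: measurable_bounded_integrable => //.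
  by rewrite mu1 ltry.
exists M; split; first exact: num_real.
by move=> x Mx s _ /=; apply: le_trans (fM s) (ltW Mx).
Qed.

Lemma Rintegral_prob_cst (c : R) : \int[mu]_s c = c.
Proof. by rewrite Rintegral_cst// mu1 mulr1. Qed.

(* [\sum_(i < N) (i + 1 < x)] is the number of positive integers below [x]. *)
Lemma count_below (N : nat) (x : R) : 0 <= x <= N%:R ->
  \sum_(i < N) (i.+1%:R < x)%R%:R <= x <= \sum_(i < N) (i.+1%:R < x)%R%:R + 1.
Proof.
elim: N x => [|N IH] x /andP[x0 xN].
  by rewrite big_ord0 x0 (le_trans xN)// add0r.
rewrite big_ord_recr/=; have -> : (N.+1%:R < x) = false by apply/negbTE; rewrite -leNgt.
rewrite addr0; have [xN'|Nx] := leP x N%:R; first by apply: IH; rewrite x0.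
have -> : \sum_(i < N) (i.+1%:R < x)%R%:R = N%:R :> R.
  rewrite (eq_bigr (fun=> 1)).
    by rewrite sumr_const card_ord.
  move=> i _; rewrite (_ : (i.+1%:R < x)%R = true)//.
  by apply: le_lt_trans Nx; rewrite ler_nat.
by rewrite (ltW Nx)/= natr1.
Qed.

Lemma Rintegral_sum_indic (N : nat) (A : nat -> set T) :
  (forall i, measurable (A i)) ->
  \int[mu]_s (\sum_(i < N) \1_(A i) s) = \sum_(i < N) fine (mu (A i)).
Proof.
move=> mA.
have i1 i : mu.-integrable setT (EFin \o \1_(A i)).
  apply: (@bounded_integrable _ 1) => // s.
  by rewrite indicE; case: (s \in A i); rewrite ?normr0 ?normr1.
have ri i : \int[mu]_s \1_(A i) s = fine (mu (A i)).
  by rewrite /Rintegral integral_indic// setIT.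
elim: N => [|N IH].
  under eq_Rintegral do rewrite big_ord0.
  by rewrite big_ord0 Rintegral_prob_cst.
under eq_Rintegral do rewrite big_ord_recr/=.
rewrite RintegralD// ?IH ?big_ord_recr/= ?ri//.
rewrite (_ : EFin \o _ = fun s => \sum_(i < N) (EFin \o \1_(A i)) s)%E.
  by apply: integrable_sum => // i _; exact: i1.
by apply/funext => s /=; rewrite sumEFin.
Qed.

(** Integrating [count_below] shows that the sum is at most N times the integral and falls short of
    it by at most 1. It therefore exceeds N c once N times the gap is above 1. Only measures of
    strict superlevel sets occur. *)
Lemma layer_sum (g : T -> R) (c : R) :
  measurable_fun setT g -> (forall s, 0 <= g s <= 1) ->
  c < \int[mu]_s g s <-> exists N : nat,
    N%:R * c < \sum_(i < N) fine (mu [set s | i.+1%:R < N%:R * g s]).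
Proof.
pose L (N i : nat) := [set s | i.+1%:R < N%:R * g s].
move=> mg g01.
have ig : mu.-integrable setT (EFin \o g).
  apply: (@bounded_integrable _ 1) => // s.
  by have /andP[g0 g1] := g01 s; rewrite ger0_norm.
have mA N i : measurable (L N i).
  rewrite /L.
  rewrite -[X in measurable X]setTI -preimage_itvoy.
  have : measurable_fun setT (fun s => N%:R * g s) by exact: measurable_funM.
  by apply.
have b N s : \sum_(i < N) \1_(L N i) s <= N%:R * g s
             <= \sum_(i < N) \1_(L N i) s + 1.
  under eq_bigr do rewrite indicE.
  rewrite (eq_bigr (fun i : 'I_N => (i.+1%:R < N%:R * g s)%R%:R)); last first.
    by move=> i _; congr (nat_of_bool _)%:R; apply/idP/idP; rewrite inE.
  have /andP[g0 g1] := g01 s.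
  by apply: count_below; rewrite mulr_ge0//= ler_piMr.
have iN (N : nat) : mu.-integrable setT (EFin \o (fun s => N%:R * g s)).
  apply: (@bounded_integrable _ N%:R) => [|s]; first exact: measurable_funM.
  by have /andP[g0 g1] := g01 s; rewrite ger0_norm ?mulr_ge0// ler_piMr.
have iS N : mu.-integrable setT
    (EFin \o (fun s => \sum_(i < N) \1_(L N i) s)).
  rewrite (_ : EFin \o _ = fun s => \sum_(i < N)
      (EFin \o \1_(L N i)) s)%E.
    apply: integrable_sum => // i _; apply: (@bounded_integrable _ 1) => // s.
    by rewrite indicE; case: (_ \in _); rewrite ?normr0 ?normr1.
  by apply/funext => s /=; rewrite sumEFin.
split=> [cg|[N]].
  have [N Nc] := @natSinv_lt R (\int[mu]_s g s - c) ltac:(by rewrite subr_gt0).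
  exists N.+1; rewrite -[ltRHS]/(\sum_(i < N.+1) fine (mu (L N.+1 i))).
  rewrite -(@Rintegral_sum_indic _ (L N.+1))//.
  have : N.+1%:R * \int[mu]_s g s <=
      \int[mu]_s (\sum_(i < N.+1) \1_(L N.+1 i) s) + 1.
    rewrite -RintegralZl// -{2}(Rintegral_prob_cst 1) -RintegralD//; last first.
      by apply: (@bounded_integrable _ 1) => // s; rewrite normr1.
    apply: le_Rintegral => //; last by move=> s _; have /andP[] := b N.+1 s.
    have i1 : mu.-integrable setT (EFin \o cst (1 : R)).
      by apply: (@bounded_integrable _ 1) => // s; rewrite normr1.
    exact: (integrableD measurableT (iS N.+1) i1).
  rewrite -lerBlDr; apply: lt_le_trans.
  rewrite ltrBrDl -ltrBrDr -mulrBr mulrC -ltr_pdivrMr// mul1r.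
  exact: Nc.
rewrite -[ltRHS]/(\sum_(i < N) fine (mu (L N i))).
rewrite -(@Rintegral_sum_indic _ (L N))// => cN.
have N0 : (0 < N)%N.
  rewrite lt0n; apply/eqP => N0; move: cN; rewrite N0 mul0r.
  under eq_Rintegral do rewrite big_ord0.
  by rewrite Rintegral_prob_cst ltxx.
rewrite -(@ltr_pM2l _ N%:R) ?ltr0n//; apply: lt_le_trans cN _.
rewrite -RintegralZl//; apply: le_Rintegral => //.
by move=> s _; have /andP[] := b N s.
Qed.

End probability_integral.

(** * The entropic certainty equivalent *)

(** After division by e^(ty) this follows from 1 + z <= e^z at z = -ty and z = (1-t)y, whose mean
    with weights 1-t and t is 0. *)
Lemma expR_bernoulli (R : realType) (t y : R) : 0 <= t <= 1 ->
  expR (t * y) <= 1 - t + t * expR y.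
Proof.
move=> /andP[t0 t1].
rewrite -[leLHS]mul1r -ler_pdivlMr ?expR_gt0// -expRN mulrDl -mulrA -expRD.
rewrite (_ : y + - (t * y) = (1 - t) * y); last by rewrite mulrBl mul1r.
apply: le_trans (_ : (1 - t) * (1 + - (t * y)) + t * (1 + (1 - t) * y) <= _).
  by rewrite le_eqVlt; apply/orP; left; apply/eqP; ring.
by apply: lerD; apply: ler_wpM2l; rewrite ?subr_ge0//; exact: expR_ge1Dx.
Qed.

Lemma upper_souslin_measurable (R : realType) d (T : measurableType d)
    (m : {measure set T -> \bar R}) (v : T -> R) : m setT = 1%E -> upper_souslin v ->
  measurable_fun [set: caratheodory_type (mu_ext m)] v.
Proof.
move=> m1 uv; apply: (measurability _ (RGenOInfty.measurableE R)) => //.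
move=> _ [_ [c ->] <-]; rewrite setTI preimage_itvoy.
exact: (souslin_caratheodory m1 (uv c)).
Qed.

Section entropic.
Context (R : realType) (S : ptopologicalType) (r eps B : R).
Hypotheses (r_lt0 : r < 0) (eps_gt0 : 0 < eps).
Implicit Types (m : {measure set (borel S) -> \bar R}) (v w : S -> R).

Let C m : measurableType _ := caratheodory_type (mu_ext m).
Let mC m : {measure set (C m) -> \bar R} := @completed_measure_extension _ _ _ m.
Let I m v : R := \int[mC m]_s expR (r * v s).

Let mC1 m : m setT = 1%E -> mC m setT = 1%E.
Proof. by move=> m1; rewrite -m1; exact: measurable_mu_extE. Qed.

Definition admissible v := upper_souslin (v : borel S -> R) /\ forall s, eps <= v s <= B.

Let mexp m v : m setT = 1%E -> admissible v ->
  measurable_fun [set: C m] (fun s => expR (r * v s)).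
Proof.
move=> m1 [uv _]; apply: measurableT_comp; first exact: measurable_expR.
by apply: measurable_funM; [exact: measurable_cst|exact: upper_souslin_measurable].
Qed.

Let iexp m v : m setT = 1%E -> admissible v ->
  (mC m).-integrable setT (EFin \o (fun s => expR (r * v s))).
Proof.
move=> m1 av; apply: (@bounded_integrable _ _ _ _ (mC1 m1) _ 1); first exact: mexp.
move=> s; rewrite gtr0_norm ?expR_gt0// -expR0 ler_expR.
by have [_ /(_ s)/andP[vs _]] := av; rewrite nmulr_rle0// ltW// (lt_le_trans eps_gt0).
Qed.

Let I_bounds m v : m setT = 1%E -> admissible v ->
  expR (r * B) <= I m v <= expR (r * eps).
Proof.
move=> m1 av; have [_ vb] := av.
have ic (c : R) : (mC m).-integrable setT (EFin \o (fun=> c)).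
  exact: (@bounded_integrable _ _ _ _ (mC1 m1) (fun=> c) `|c|).
rewrite -{1}(Rintegral_prob_cst (mC1 m1) (expR (r * B))).
rewrite -(Rintegral_prob_cst (mC1 m1) (expR (r * eps))).
apply/andP; split.
  apply: le_Rintegral => //; first exact: iexp.
  by move=> s _; rewrite ler_expR ler_nM2l//; have /andP[] := vb s.
apply: le_Rintegral => //; first exact: iexp.
by move=> s _; rewrite ler_expR ler_nM2l//; have /andP[] := vb s.
Qed.

Let I_gt0 m v : m setT = 1%E -> admissible v -> 0 < I m v.
Proof.
by move=> m1 av; have /andP[+ _] := I_bounds m1 av; apply: lt_le_trans; exact: expR_gt0.
Qed.

Lemma entropic_bounds m v : m setT = 1%E -> admissible v ->
  eps <= entropic r m v <= B.
Proof.
move=> m1 av; have /andP[h1 h2] := I_bounds m1 av.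
rewrite /entropic -/(I m v).
have I0 := I_gt0 m1 av.
apply/andP; split; rewrite mulrC ?ler_ndivlMr ?ler_ndivrMr// mulrC -ler_expR lnK//.
Qed.

(** With L = ln E e^(rw), [expR_bernoulli] bounds e^(trw) by e^(tL) (1 - t + t e^(rw - L)). The last
    exponential has integral 1, so integration leaves e^(tL). The case t = 1 is monotonicity. *)
Lemma entropic_scale m v w t : m setT = 1%E -> admissible v -> admissible w ->
  0 <= t <= 1 -> (forall s, t * w s <= v s) ->
  t * entropic r m w <= entropic r m v.
Proof.
move=> m1 av aw t01 tw; rewrite /entropic -/(I m v) -/(I m w).
rewrite mulrCA ler_nM2l ?invr_lt0//.
have /andP[t0 t1] := t01.
rewrite -ler_expR lnK ?posrE ?I_gt0//.
set L := ln (I m w).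
have IL : expR L = I m w by rewrite /L lnK ?posrE ?I_gt0.
have ic (c : R) : (mC m).-integrable setT (EFin \o (fun=> c)).
  exact: (@bounded_integrable _ _ _ _ (mC1 m1) (fun=> c) `|c|).
have iZ : (mC m).-integrable setT
    (EFin \o (fun s => expR (t * L - L) * t * expR (r * w s))).
  exact: (integrableZl measurableT (expR (t * L - L) * t) (iexp m1 aw)).
apply: le_trans (_ : \int[mC m]_s
   (expR (t * L) * (1 - t) + expR (t * L - L) * t * expR (r * w s)) <= _).
  apply: le_Rintegral => //; first exact: iexp.
    exact: (integrableD measurableT (ic _) iZ).
  move=> s _; apply: le_trans (_ : expR (t * (r * w s)) <= _).
    by rewrite ler_expR mulrCA ler_nM2l.
  have -> : t * (r * w s) = t * L + t * (r * w s - L) by ring.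
  rewrite expRD -!mulrA (expRD (t * L)) -mulrA -mulrDr ler_pM2l ?expR_gt0//.
  rewrite [in leRHS](mulrC (expR (- L))) -mulrA -expRD.
  exact: expR_bernoulli.
rewrite RintegralD//.
rewrite (Rintegral_prob_cst (mC1 m1)) RintegralZl//; last exact: iexp.
rewrite -/(I m w) -IL mulrAC -expRD subrK -mulrDr subrK mulr1.
exact: lexx.
Qed.

(** Since r < 0, the function [g] = 1 - e^(rv) increases with [v] and stays in [0, 1], and the
    entropic value exceeds [c] exactly when the integral of [g] exceeds 1 - e^(rc). Then [layer_sum]
    and [souslin_kernel] apply. *)
Lemma upper_souslin_entropic d (T : measurableType d) (q : R.-pker T ~> (borel S)) v :
  admissible v -> upper_souslin (fun k => entropic r (q k) v).
Proof.
move=> av c; have [uv vb] := av.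
have q1 k : q k setT = 1%E by exact: prob_kernel.
pose g s := 1 - expR (r * v s).
have ug : upper_souslin (g : borel S -> R).
  move=> e; have [e1|e1] := leP 1 e.
    apply: (@souslin_rel_ext _ _ (fun s _ => set0 s)).
      move=> s _; split=> //=; rewrite ltNge => /negP; apply; rewrite /g.
      by rewrite (le_trans _ e1)// gerBl expR_ge0.
    by apply: souslin_measurable; exact: measurable0.
  apply: souslin_rel_ext (uv (ln (1 - e) / r)) => s _ /=.
  have -> : (ln (1 - e) / r < v s) = (expR (r * v s) < 1 - e).
    by rewrite ltr_ndivrMr// -[LHS]ltr_expR lnK ?posrE ?subr_gt0// [v s * r]mulrC.
  by rewrite /g ltrBrDr addrC -ltrBrDr.
have usaA (N i : nat) : upper_souslin (fun k =>
    fine (mu_ext (q k) [set s | i.+1%:R < N%:R * g s])).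
  move=> e; have sA : souslin ([set s | i.+1%:R < N%:R * g s] : set (borel S)).
    case: N => [|N].
      apply: (@souslin_rel_ext _ _ (fun s _ => set0 s)).
        by move=> s _; split=> //=; rewrite mul0r ltNge ler0n.
      by apply: souslin_measurable; exact: measurable0.
    apply: souslin_rel_ext (ug (i.+1%:R / N.+1%:R)) => s _ /=.
    by rewrite ltr_pdivrMr// mulrC.
  apply: souslin_rel_ext (souslin_kernel q e sA) => k _ /=.
  rewrite -lte_fin fineK// ge0_fin_numE ?outer_measure_ge0//.
  apply: (@le_lt_trans _ _ 1%E); last exact: ltry.
  by rewrite -(q1 k) -(measurable_mu_extE (q k))//; exact: le_outer_measure.
apply: (@souslin_rel_ext _ _ (fun k _ => exists N : nat, N%:R * (1 - expR (r * c)) <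
    \sum_(i < N) fine (mu_ext (q k) [set s | i.+1%:R < N%:R * g s]))); last first.
  apply: souslin_rel_exist => N.
  exact: (@upper_souslin_sum _ _ _ (fun i k => fine (mu_ext (q k)
    [set s | i.+1%:R < N%:R * g s])) N (usaA N) (N%:R * (1 - expR (r * c)))).
move=> k _ /=.
have mg : measurable_fun [set: C (q k)] g.
  exact: (measurable_funB (measurable_cst _) (mexp (q1 k) av)).
rewrite -(layer_sum (mC1 (q1 k)) (1 - expR (r * c)) mg); last first.
  move=> s; rewrite /g subr_ge0 gerBl expR_ge0 andbT -expR0 ler_expR.
  by have /andP[vs _] := vb s; rewrite nmulr_rle0// ltW// (lt_le_trans eps_gt0).
rewrite RintegralB//; last 2 first.
- by apply: (@bounded_integrable _ _ _ _ (mC1 (q1 k)) (fun=> 1) 1) => // s; rewrite normr1.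
- exact: iexp.
rewrite (Rintegral_prob_cst (mC1 (q1 k))) ltrD2l ltrN2 /entropic -/(I (q k) v).
rewrite [r^-1 * _]mulrC ltr_ndivlMr// [c * r]mulrC.
by rewrite -(ltr_expR (ln _)) lnK ?posrE ?I_gt0.
Qed.

End entropic.

(** * The aggregator *)

Section powers.
Context (R : realType).
Implicit Types x y p : R.

Lemma ler_powR_pos p x y : 0 < p -> 0 < x -> 0 < y -> (x `^ p <= y `^ p) = (x <= y).
Proof.
move=> p0 x0 y0; rewrite -[LHS]ler_ln ?posrE ?powR_gt0// !ln_powR ler_pM2l//.
by rewrite ler_ln.
Qed.

Lemma ler_powR_neg p x y : p < 0 -> 0 < x -> 0 < y -> (x `^ p <= y `^ p) = (y <= x).
Proof.
move=> p0 x0 y0; rewrite -[LHS]ler_ln ?posrE ?powR_gt0// !ln_powR ler_nM2l//.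
by rewrite ler_ln.
Qed.

Lemma one_powR p : 1 `^ p = 1 :> R.
Proof. by rewrite powR1. Qed.

Lemma powRK p x : p != 0 -> 0 <= x -> (x `^ p) `^ p^-1 = x.
Proof. by move=> p0 x0; rewrite -powRrM divff// powRr1. Qed.

Lemma powRVK p x : p != 0 -> 0 <= x -> (x `^ p^-1) `^ p = x.
Proof. by move=> p0 x0; rewrite -powRrM mulVf// powRr1. Qed.

Lemma geometric_lt (th c e : R) : 0 <= th < 1 -> 0 < e -> exists n, th ^+ n * c < e.
Proof.
move=> /andP[th0 th1] e0.
have [c0|c0] := leP c 0.
  by exists 0%N; rewrite expr0 mul1r (le_lt_trans c0).
have /cvgrPdist_lt/(_ (e / c)) : (fun n => th ^+ n) @ \oo --> (0 : R).
  by apply: cvg_expr; rewrite ger0_norm.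
rewrite divr_gt0// => /(_ isT)[n _ /(_ n (leqnn n))].
rewrite /= sub0r normrN ger0_norm ?exprn_ge0// ltr_pdivlMr// => ?.
by exists n.
Qed.

End powers.

Section aggregator.
Context (R : realType) (b0 b1 beta p eps B : R).
Hypotheses (b0_gt0 : 0 < b0) (beta_bounds : 0 <= beta < 1) (p_neq0 : p != 0).
Hypotheses (eps_gt0 : 0 < eps) (eps_lt_B : eps < B).

Let b_ge0 : 0 <= beta. Proof. by case/andP: beta_bounds. Qed.
Let b1_gt0 : 0 < 1 - beta. Proof. by rewrite subr_gt0; case/andP: beta_bounds. Qed.

Definition aggregator (u m : R) := ((1 - beta) * (u `^ p) + beta * (m `^ p)) `^ p^-1.

Let den_gt0 u m : 0 < u -> 0 < (1 - beta) * (u `^ p) + beta * (m `^ p).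
Proof.
move=> u0; rewrite ltr_wpDr//; first by rewrite mulr_ge0// powR_ge0.
by rewrite mulr_gt0// powR_gt0.
Qed.

Lemma agg_le u u' m m' : 0 < u -> 0 < m -> u <= u' -> m <= m' ->
  aggregator u m <= aggregator u' m'.
Proof.
move=> u0 m0 uu' mm'; rewrite /aggregator.
have u0' : 0 < u' by exact: lt_le_trans uu'.
have m0' : 0 < m' by exact: lt_le_trans mm'.
have d0 := den_gt0 m u0; have d0' := den_gt0 m' u0'.
have /orP[p0|p0] := lt_total p_neq0.
  rewrite ler_powR_neg ?invr_lt0//.
  by apply: lerD; apply: ler_wpM2l; rewrite ?(ltW b1_gt0)// ler_powR_neg.
rewrite ler_powR_pos ?invr_gt0//.
by apply: lerD; apply: ler_wpM2l; rewrite ?(ltW b1_gt0)// ler_powR_pos.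
Qed.

Let agg_diag c : 0 < c -> aggregator c c = c.
Proof. by move=> c0; rewrite /aggregator -mulrDl subrK mul1r powRK// ltW. Qed.

Let agg0 c : 0 < c -> ((1 - beta) * c `^ p) `^ p^-1 = (1 - beta) `^ p^-1 * c.
Proof.
by move=> c0; rewrite powRM ?powR_ge0 ?(ltW b1_gt0)// powRK// ltW.
Qed.

Hypothesis const_neg : p < 0 -> eps <= b0 /\ (1 - beta) `^ p^-1 * b1 <= B.
Hypothesis const_pos : 0 < p -> eps <= (1 - beta) `^ p^-1 * b0 /\ b1 <= B.

(** One bound comes from the diagonal value [aggregator c c] = c, the other from dropping the term
    in [m]. For p < 0 dropping it raises the aggregator, for p > 0 it lowers it; hence the two sets
    of conditions on [eps] and [B]. *)
Lemma agg_bounds u m : b0 <= u <= b1 -> eps <= m <= B -> eps <= aggregator u m <= B.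
Proof.
move=> /andP[u0 u1] /andP[m0 m1].
have up : 0 < u by exact: lt_le_trans u0.
have mp : 0 < m by exact: lt_le_trans m0.
have Bp : 0 < B by exact: lt_trans eps_lt_B.
have b1p : 0 < b1 by exact: lt_le_trans u1.
have pe : 0 < 1 - beta by [].
have n0 c : 0 < c -> 0 < (1 - beta) * c `^ p.
  by move=> c0; rewrite mulr_gt0 ?powR_gt0.
have d0 := den_gt0 m up.
have /orP[p0|p0] := lt_total p_neq0.
  have [h1 h2] := const_neg p0; apply/andP; split.
    rewrite -[leLHS](agg_diag eps_gt0).
    exact: agg_le eps_gt0 eps_gt0 (le_trans h1 u0) m0.
  apply: le_trans h2; rewrite -(agg0 b1p).
  rewrite /aggregator ler_powR_neg ?invr_lt0 ?n0//.
  rewrite -[leLHS]addr0; apply: lerD; last by rewrite mulr_ge0 ?powR_ge0.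
  by apply: ler_wpM2l; rewrite ?(ltW b1_gt0)// ler_powR_neg.
have [h1 h2] := const_pos p0; apply/andP; split.
  apply: le_trans h1 _; rewrite -(agg0 b0_gt0).
  rewrite /aggregator ler_powR_pos ?invr_gt0 ?n0//.
  rewrite -[leLHS]addr0; apply: lerD; last by rewrite mulr_ge0 ?powR_ge0.
  by apply: ler_wpM2l; rewrite ?(ltW b1_gt0)// ler_powR_pos.
rewrite -[leRHS](agg_diag Bp).
exact: agg_le up mp (le_trans u1 h2) m1.
Qed.

Hypothesis b0_lt_b1 : b0 < b1.

(** [a0] bounds the term in u^p from below and [M1] bounds m^p from above, for either sign of p. The
    share of the continuation term is largest at these two extremes, where it equals [theta]. *)
Let a0 := (1 - beta) * Num.min (b0 `^ p) (b1 `^ p).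
Let M1 := Num.max (eps `^ p) (B `^ p).
Definition theta := beta * M1 / (a0 + beta * M1).

Let a0_gt0 : 0 < a0.
Proof.
rewrite /a0 mulr_gt0// lt_min !powR_gt0//; exact: lt_trans b0_lt_b1.
Qed.

Let M1_gt0 : 0 < M1.
Proof. by rewrite /M1 lt_max powR_gt0. Qed.

Let d_gt0 : 0 < a0 + beta * M1.
Proof. by rewrite ltr_wpDr// mulr_ge0// ltW. Qed.

Lemma theta_bounds : 0 <= theta < 1.
Proof.
by rewrite /theta divr_ge0 ?mulr_ge0 ?(ltW M1_gt0) ?(ltW d_gt0)//= ltr_pdivrMr// mul1r ltrDr.
Qed.

Let theta_frac u m : b0 <= u <= b1 -> eps <= m <= B ->
  beta * m `^ p <= theta * ((1 - beta) * u `^ p + beta * m `^ p).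
Proof.
move=> /andP[u0 u1] /andP[m0 m1].
have up : 0 < u by exact: lt_le_trans u0.
have mp : 0 < m by exact: lt_le_trans m0.
have Bp : 0 < B by exact: lt_trans eps_lt_B.
have b1p : 0 < b1 by exact: lt_le_trans u1.
have ua : a0 <= (1 - beta) * u `^ p.
  rewrite /a0 ler_wpM2l ?(ltW b1_gt0)// ge_min.
  have /orP[p0|p0] := lt_total p_neq0.
    by rewrite !ler_powR_neg// u1 orbT.
  by rewrite !ler_powR_pos// u0.
have mM : m `^ p <= M1.
  rewrite /M1 le_max.
  have /orP[p0|p0] := lt_total p_neq0.
    by rewrite !ler_powR_neg// m0.
  by rewrite !ler_powR_pos// m1 orbT.
rewrite /theta mulrAC ler_pdivlMr// !mulrDr [_ * (beta * M1)]mulrC.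
rewrite lerD2r -!mulrA ler_wpM2l//.
by apply: ler_pM => //; [exact: powR_ge0|exact: ltW].
Qed.

Definition shrink (x : R) := (1 + theta * (x - 1)) `^ p^-1.

(** Scaling [m] by [t] adds (t^p - 1) beta m^p to the base D of the power, and beta m^p <= theta D.
    For p < 0 the factor is nonnegative and x^(1/p) decreases; for p > 0 both signs are reversed. *)
Lemma agg_scale u m t : b0 <= u <= b1 -> eps <= m <= B -> 0 < t <= 1 ->
  shrink (t `^ p) * aggregator u m <= aggregator u (t * m).
Proof.
move=> ub mb /andP[t0 t1].
have frac := theta_frac ub mb.
move/andP: ub mb => [u0 u1] /andP[m0 m1].
have up : 0 < u by exact: lt_le_trans u0.
have mp : 0 < m by exact: lt_le_trans m0.
have /andP[th0 th1] := theta_bounds.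
have tp : 0 < t `^ p by exact: powR_gt0.
have sh0 : 0 < 1 + theta * (t `^ p - 1).
  rewrite (_ : _ + _ = (1 - theta) + theta * t `^ p); last by ring.
  by rewrite ltr_pwDl ?subr_gt0// mulr_ge0// ltW.
rewrite /shrink /aggregator -powRM ?(ltW sh0) ?(ltW (den_gt0 _ up))//.
set D := (1 - beta) * u `^ p + beta * m `^ p in frac *.
have -> : (t * m) `^ p = t `^ p * m `^ p by rewrite powRM// ltW.
have D0 : 0 < D by exact: den_gt0.
have E0 : 0 < (1 - beta) * u `^ p + beta * (t `^ p * m `^ p).
  rewrite ltr_wpDr//; first by rewrite !mulr_ge0// powR_ge0.
  by rewrite mulr_gt0// powR_gt0.
have /orP[p0|p0] := lt_total p_neq0.
  rewrite ler_powR_neg ?invr_lt0 ?mulr_gt0//.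
  have tge : 0 <= t `^ p - 1.
    by rewrite subr_ge0 -(one_powR p) ler_powR_neg.
  have := ler_wpM2l tge frac; rewrite /D; move: (u `^ p) (m `^ p) (t `^ p) => *.
  nra.
rewrite ler_powR_pos ?invr_gt0 ?mulr_gt0//.
have tge : 0 <= 1 - t `^ p.
  by rewrite subr_ge0 -(one_powR p) ler_powR_pos.
have := ler_wpM2l tge frac; rewrite /D; move: (u `^ p) (m `^ p) (t `^ p) => *.
nra.
Qed.

(** Closed form of the iterates of t -> t' from eps / B, since t^p - 1 is multiplied by [theta] each
    time. *)
Definition ratio n : R := (1 + theta ^+ n * ((eps / B) `^ p - 1)) `^ p^-1.

Let Bp : 0 < B. Proof. exact: lt_trans eps_lt_B. Qed.

Let r0_gt0 : 0 < eps / B. Proof. by rewrite divr_gt0. Qed.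

Let ratio_base n : 0 < 1 + theta ^+ n * ((eps / B) `^ p - 1).
Proof.
have /andP[th0 th1] := theta_bounds.
have tn1 : theta ^+ n <= 1 by rewrite exprn_ile1// ltW.
have tn0 : 0 <= theta ^+ n by rewrite exprn_ge0.
have := powR_gt0 p r0_gt0; move: (theta ^+ n) ((eps / B) `^ p) tn0 tn1 => x y x0 x1 y0.
nra.
Qed.

Lemma ratio0 : ratio 0 = eps / B.
Proof. by rewrite /ratio expr0 mul1r addrC subrK powRK// ltW. Qed.

Lemma ratioS n : ratio n.+1 = shrink (ratio n `^ p).
Proof.
rewrite /shrink /ratio powRVK ?(ltW (ratio_base n))// exprS; congr (_ `^ _).
by ring.
Qed.

Lemma ratio_bounds n : 0 < ratio n <= 1.
Proof.
have /andP[th0 th1] := theta_bounds.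
have tn0 : 0 <= theta ^+ n by rewrite exprn_ge0.
rewrite powR_gt0//= -[leRHS](one_powR p^-1).
have le1 : eps / B <= 1 by rewrite ler_pdivrMr// mul1r ltW.
have /orP[p0|p0] := lt_total p_neq0.
  rewrite ler_powR_neg ?invr_lt0// lerDl mulr_ge0// subr_ge0 -(one_powR p).
  by rewrite ler_powR_neg.
rewrite ler_powR_pos ?invr_gt0// gerDl mulr_ge0_le0// subr_le0 -(one_powR p).
by rewrite ler_powR_pos.
Qed.

(** If b < a, the ratios stay below b / a < 1, so their p-th powers keep a fixed distance from 1,
    against the geometric decay of theta^n. *)
Lemma ratio_limit (a b : R) : 0 < a -> 0 < b -> (forall n, ratio n * a <= b) -> a <= b.
Proof.
move=> a_gt0 b_gt0 H; rewrite leNgt; apply/negP => ba.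
have x0 : 0 < b / a by rewrite divr_gt0.
have x1 : b / a < 1 by rewrite ltr_pdivrMr// mul1r.
have Hn n : ratio n <= b / a by rewrite ler_pdivlMr.
have eqb n : ratio n `^ p = 1 + theta ^+ n * ((eps / B) `^ p - 1).
  by rewrite /ratio powRVK// ltW.
have rp n : 0 < ratio n by case/andP: (ratio_bounds n).
have /orP[p0|p0] := lt_total p_neq0.
  have e0 : 0 < (b / a) `^ p - 1.
    by rewrite subr_gt0 -(one_powR p) ltNge ler_powR_neg// -ltNge.
  have [n] := geometric_lt ((eps / B) `^ p - 1) theta_bounds e0.
  apply/negP; rewrite -leNgt lerBlDl -eqb ler_powR_neg//.
have e0 : 0 < 1 - (b / a) `^ p.
  by rewrite subr_gt0 -(one_powR p) ltNge ler_powR_pos// -ltNge.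
have [n] := geometric_lt (1 - (eps / B) `^ p) theta_bounds e0.
apply/negP; rewrite -leNgt lerBlDl -lerBlDr -mulrN opprB -eqb ler_powR_pos//.
Qed.

End aggregator.

(** The points of [D] where [h] exceeds [e] form an up-set of [D]. If it has a least point [a], the
    condition is a <= f s, a countable intersection; if not, a rational can be placed below f s and
    above a point of the up-set. *)
Lemma upper_souslin_incr (R : realType) d (T : measurableType d) (f : T -> R) (D : set R)
    (h : R -> R) : upper_souslin f -> (forall s, D (f s)) ->
  (forall x y, D x -> D y -> x <= y -> h x <= h y) -> upper_souslin (fun s => h (f s)).
Proof.
move=> uf Df hD e.
have [[a [Da ea amin]]|nomin] := pselect (exists a, [/\ D a, e < h a &
    forall x, D x -> e < h x -> a <= x]).
  apply: (@souslin_rel_ext _ _ (fun s _ => forall n, a - n.+1%:R^-1 < f s)).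
    move=> s _ /=; split=> [H|ef n]; last first.
      by rewrite (lt_le_trans _ (amin _ (Df s) ef))// gtrBl.
    apply: lt_le_trans ea _; apply: hD => //; apply/ler_addgt0Pr => x x0.
    have [n nx] := natSinv_lt x0.
    by have := H n; rewrite ltrBlDr => /ltW /le_trans; apply; rewrite lerD2l ltW.
  by apply: souslin_rel_forall => n; exact: uf.
apply: (@souslin_rel_ext _ _ (fun s _ => exists x : rat,
    (exists2 z, D z /\ e < h z & z <= ratr x) /\ ratr x < f s)).
  move=> s _ /=; split=> [[x [[z [Dz ez] zx] xf]]|ef].
    by apply: lt_le_trans ez _; apply: hD => //; exact: ltW (le_lt_trans zx xf).
  have [z [Dz ez zf]] : exists z, [/\ D z, e < h z & z < f s].
    apply: contrapT => H; apply: nomin; exists (f s); split=> // x Dx ex.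
    by rewrite leNgt; apply/negP => xf; apply: H; exists x.
  have [x /andP[zx xf]] := ratr_between zf.
  by exists x; split=> //; exists z; rewrite ?ltW.
apply: souslin_rel_exist => x; apply: souslin_rel_and; last exact: uf.
suff [] : bisouslin (fun (_ : T) (_ : baire) => exists2 z, D z /\ e < h z & z <= ratr x) by [].
by apply: (@bisouslin_prop _ _ (fun=> exists2 z, D z /\ e < h z & z <= ratr x)); exists 0%N.
Qed.

Lemma measurable_upper_souslin (R : realType) d (T : measurableType d) (f : T -> R) :
  measurable_fun setT f -> upper_souslin f.
Proof.
move=> mf c; apply: souslin_measurable.
by rewrite -[X in measurable X]setTI -preimage_itvoy; exact: mf.
Qed.

Lemma upper_souslin_agg (R : realType) (beta p : R) d (T : measurableType d) (u m : T -> R) :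
  0 <= beta < 1 -> p != 0 -> measurable_fun setT u -> upper_souslin m ->
  (forall k, 0 < u k) -> (forall k, 0 < m k) ->
  upper_souslin (fun k => aggregator beta p (u k) (m k)).
Proof.
move=> /andP[b0 b1] p_neq0 mu um u0 m0.
have b1' : 0 <= 1 - beta by rewrite subr_ge0 ltW.
have uu := measurable_upper_souslin mu.
have den k : 0 < (1 - beta) * u k `^ p + beta * m k `^ p.
  by rewrite ltr_wpDr ?mulr_ge0 ?powR_ge0// mulr_gt0 ?subr_gt0// powR_gt0.
have /orP[p0|p0] := lt_total p_neq0.
  (* For p < 0 powers decrease, so signs are changed to work with increasing maps: -(a x^p) inside
     and (-x)^(1/p) on the negative reals outside. *)
  pose h a x := - (a * x `^ p).
  have hincr a x y : 0 <= a -> 0 < x -> 0 < y -> x <= y -> h a x <= h a y.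
    by move=> a0 x0 y0 xy; rewrite /h lerN2 ler_wpM2l// ler_powR_neg.
  have us : upper_souslin (fun k => h (1 - beta) (u k) + h beta (m k)).
    by apply: upper_souslinD; [apply: (@upper_souslin_incr _ _ _ u [set x | 0 < x])|
      apply: (@upper_souslin_incr _ _ _ m [set x | 0 < x])] => // x y; exact: hincr.
  have := @upper_souslin_incr _ _ _ _ [set x | x < 0] (fun x => (- x) `^ p^-1) us.
  rewrite /h => H c; apply: souslin_rel_ext (H _ _ c) => [k _ /=|k|x y /= x0 y0 xy].
  - by rewrite -opprD opprK.
  - by rewrite /= -opprD oppr_lt0.
  - by rewrite ler_powR_neg ?invr_lt0 ?oppr_gt0// lerN2.
pose h a x := a * x `^ p.
have hincr a x y : 0 <= a -> 0 < x -> 0 < y -> x <= y -> h a x <= h a y.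
  by move=> a0 x0 y0 xy; rewrite /h ler_wpM2l// ler_powR_pos.
have us : upper_souslin (fun k => h (1 - beta) (u k) + h beta (m k)).
  by apply: upper_souslinD; [apply: (@upper_souslin_incr _ _ _ u [set x | 0 < x])|
    apply: (@upper_souslin_incr _ _ _ m [set x | 0 < x])] => // x y; exact: hincr.
apply: (@upper_souslin_incr _ _ _ _ [set x | 0 < x] (fun x => x `^ p^-1) us) => //.
move=> x y /= x0 y0 xy.
by rewrite ler_powR_pos ?invr_gt0.
Qed.

(** * The Bellman operator *)

Section bellman.
Context (R : realType) (S A : ptopologicalType) (K : nonemptyBorel (S * A)%type).
Context (q : R.-pker (borel K) ~> (borel S)) (u : K -> R).
Context (b0 b1 beta r p eps B : R) (U : nat -> set S) (V : nat -> set A).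
Hypotheses (bU : seq_base U) (bV : seq_base V).
Hypotheses (codS : codable S) (codA : codable A).
Hypothesis sepU : forall a b, (forall n, U n a <-> U n b) -> a = b.
Hypothesis K_section : forall s : S, exists a : A, carrier K (s, a).
Hypothesis u_meas : measurable_fun [set: borel K] u.
Hypotheses (b0_gt0 : 0 < b0) (b0_lt_b1 : b0 < b1).
Hypothesis u_bounds : forall k : K, b0 <= u k <= b1.
Hypotheses (beta_bounds : 0 <= beta < 1) (r_lt0 : r < 0) (p_neq0 : p != 0).
Hypotheses (eps_gt0 : 0 < eps) (eps_lt_B : eps < B).
Hypothesis const_neg : p < 0 -> eps <= b0 /\ (1 - beta) `^ p^-1 * b1 <= B.
Hypothesis const_pos : 0 < p -> eps <= (1 - beta) `^ p^-1 * b0 /\ b1 <= B.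
Implicit Types v w : S -> R.

Let F v (k : K) := aggregator beta p (u k) (entropic r (q k) v).
Let T v (s : S) := sup [set F v k | k in [set k : K | (val k).1 = s]].
Let rho n := ratio b0 b1 beta p eps B n.
Let adm v := admissible eps B v.

Let B_gt0 : 0 < B. Proof. exact: lt_trans eps_lt_B. Qed.

Let q1 k : q k setT = 1%E. Proof. exact: prob_kernel. Qed.

Let M_bounds v k : adm v -> eps <= entropic r (q k) v <= B.
Proof. by move=> av; exact: (entropic_bounds r_lt0 eps_gt0). Qed.

Let M_gt0 v k : adm v -> 0 < entropic r (q k) v.
Proof. by move=> /(M_bounds k)/andP[+ _]; exact: lt_le_trans. Qed.

Let u_gt0 k : 0 < u k.
Proof. by have /andP[+ _] := u_bounds k; exact: lt_le_trans. Qed.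

Let F_bounds v k : adm v -> eps <= F v k <= B.
Proof.
by move=> av; apply: (agg_bounds b0_gt0 beta_bounds p_neq0 eps_gt0 eps_lt_B
  const_neg const_pos); [exact: u_bounds|exact: M_bounds].
Qed.

Let has_sup_F v s : adm v -> has_sup [set F v k | k in [set k : K | (val k).1 = s]].
Proof.
move=> av; split.
  have [a Ksa] := K_section s; exists (F v (corestr K (s, a))).
  by exists (corestr K (s, a)) => //=; rewrite corestrE.
by exists B => _ [k _ <-]; have /andP[] := F_bounds k av.
Qed.

Let F_le_T v s k : adm v -> (val k).1 = s -> F v k <= T v s.
Proof.
move=> av ks; apply: ub_le_sup; first by have [] := has_sup_F s av.
by exists k.
Qed.

Let T_le v s c : adm v -> (forall k : K, (val k).1 = s -> F v k <= c) -> T v s <= c.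
Proof.
move=> av Fc; apply: ge_sup; first by have [] := has_sup_F s av.
by move=> _ [k ks <-]; exact: Fc.
Qed.

Let over s : exists k : K, (val k).1 = s.
Proof.
by have [a Ksa] := K_section s; exists (corestr K (s, a)); rewrite corestrE.
Qed.

Let T_adm v : adm v -> adm (T v).
Proof.
move=> av; split=> [c|s]; last first.
  apply/andP; split; last by apply: T_le => // k _; have /andP[] := F_bounds k av.
  have [k ks] := over s; apply: le_trans (F_le_T av ks).
  by have /andP[] := F_bounds k av.
have uF : upper_souslin (F v : borel K -> R).
  apply: upper_souslin_agg => //; last by move=> k; exact: M_gt0.
  exact: (upper_souslin_entropic r_lt0 eps_gt0 q av).
(* A supremum exceeds [c] exactly when one of its terms does, so the superlevel set is a projection
   from [K], even if no action is optimal. *)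
apply: souslin_rel_ext (souslin_section bU bV codA (uF c)) => s _ /=.
split=> [[k [ks cF]]|cT]; first exact: lt_le_trans (F_le_T av ks).
by have [_ [k ks <-] cF] := sup_gt (has_sup_F s av).1 cT; exists k.
Qed.

Let T_mono v w s : adm v -> adm w -> (forall s, w s <= v s) -> T w s <= T v s.
Proof.
move=> av aw wv; apply: T_le => // k ks; apply: le_trans (F_le_T av ks).
apply: (agg_le beta_bounds p_neq0 (u_gt0 k) (M_gt0 k aw) (lexx _)).
(* Monotonicity of the certainty equivalent is the scaling inequality at t = 1. *)
rewrite -[leLHS]mul1r; apply: (entropic_scale r_lt0 eps_gt0 (q1 k) av aw).
  by rewrite ler01 lexx.
by move=> s'; rewrite mul1r.
Qed.

Let rho_bounds n : 0 < rho n <= 1. Proof. exact: ratio_bounds. Qed.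

Let T_ratio v w n : adm v -> adm w -> (forall s, rho n * w s <= v s) ->
  forall s, rho n.+1 * T w s <= T v s.
Proof.
move=> av aw wv s; have /andP[r0 r1] := rho_bounds n.
have /andP[rS0 _] := rho_bounds n.+1.
rewrite mulrC -ler_pdivlMr//; apply: T_le => // k ks; rewrite ler_pdivlMr// mulrC.
apply: le_trans (F_le_T av ks).
apply: (@le_trans _ _ (aggregator beta p (u k) (rho n * entropic r (q k) w))).
  rewrite /rho (ratioS b0_gt0 beta_bounds p_neq0 eps_gt0 eps_lt_B b0_lt_b1).
  exact: (agg_scale b0_gt0 beta_bounds p_neq0 eps_gt0 eps_lt_B b0_lt_b1
    (u_bounds k) (M_bounds k aw) (rho_bounds n)).
apply: (agg_le beta_bounds p_neq0 (u_gt0 k) _ (lexx _)).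
  by rewrite mulr_gt0// M_gt0.
by apply: (entropic_scale r_lt0 eps_gt0 (q1 k) av aw) => //; rewrite (ltW r0).
Qed.

Let rho0_le v w s : adm v -> adm w -> rho 0 * w s <= v s.
Proof.
move=> [_ /(_ s)/andP[vs _]] [_ /(_ s)/andP[_ ws]].
rewrite /rho (ratio0 _ _ _ p_neq0 eps_gt0 eps_lt_B); apply: le_trans vs.
by rewrite mulrAC ler_pdivrMr// ler_pM2l.
Qed.

Let rho_limit v w s : adm v -> adm w -> (forall n, rho n * w s <= v s) -> w s <= v s.
Proof.
move=> [_ /(_ s)/andP[vs _]] [_ /(_ s)/andP[ws _]].
by apply: (ratio_limit b0_gt0 beta_bounds) => //; exact: lt_le_trans eps_gt0 _.
Qed.

Let fixed_le v w : adm v -> adm w -> v = T v -> w = T w -> forall s, w s <= v s.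
Proof.
move=> av aw vT wT s; apply: rho_limit => // n; move: s.
by elim: n => [s|n IH s]; [exact: rho0_le|rewrite vT wT; exact: T_ratio].
Qed.

Let vn n := iter n T (fun=> eps).

Let vn_adm n : adm (vn n).
Proof.
elim: n => [|n IH]; last exact: T_adm.
split=> [|s]; last by rewrite lexx ltW.
by apply: measurable_upper_souslin; exact: measurable_cst.
Qed.

Let vn_le n s : vn n s <= vn n.+1 s.
Proof.
elim: n s => [s|n IH s]; last exact: (T_mono s (vn_adm n.+1) (vn_adm n) IH).
by have [_ /(_ s)/andP[]] := vn_adm 1.
Qed.

Let vlim s := sup (range (vn ^~ s)).

Let vn_vlim n s : vn n s <= vlim s.
Proof.
apply: ub_le_sup; last by exists n.
by exists B => _ [k _ <-]; have [_ /(_ s)/andP[]] := vn_adm k.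
Qed.

Let vlim_le s c : (forall n, vn n s <= c) -> vlim s <= c.
Proof.
by move=> vc; apply: ge_sup => [|_ [n _ <-]//]; exists (vn 0 s), 0%N.
Qed.

Let vlim_adm : adm vlim.
Proof.
split=> [c|s]; last first.
  rewrite (le_trans _ (vn_vlim 0 s))//=; apply: vlim_le => n.
  by have [_ /(_ s)/andP[]] := vn_adm n.
apply: (@souslin_rel_ext _ (borel S) (fun s _ => exists n, c < vn n s)).
  move=> s _ /=; split=> [[n cn]|cv]; first exact: lt_le_trans (vn_vlim n s).
  have [|_ [n _ <-] cn] := sup_gt _ cv; last by exists n.
  by exists (vn 0 s), 0%N.
by apply: souslin_rel_exist => n; have [+ _] := vn_adm n; apply.
Qed.

(** The ratio estimate replaces an interchange of limit and T. Monotonicity gives vlim <= T vlim,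
    which lets [rho n * vlim <= vn n] propagate in n. One more application of T bounds
    [rho n.+1 * T vlim] by [vn n.+1], hence by [vlim], and the ratios tend to 1. *)
Let vlim_fixed : vlim = T vlim.
Proof.
have leT s : vlim s <= T vlim s.
  apply: vlim_le => n; apply: le_trans (vn_le n s) _.
  by apply: T_mono => // s'; exact: vn_vlim.
have rv n s : rho n * vlim s <= vn n s.
  elim: n s => [s|n IH s]; first exact: rho0_le.
  apply: le_trans (T_ratio (vn_adm n) vlim_adm IH s).
  by rewrite ler_pM2l ?leT//; have /andP[] := rho_bounds n.+1.
apply/funext => s; apply/eqP; rewrite eq_le leT /=.
apply: rho_limit => // [|n]; first exact: T_adm.
case: n => [|n]; first by apply: rho0_le => //; exact: T_adm.
by apply: le_trans (vn_vlim n.+1 s); exact: T_ratio.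
Qed.

Lemma bellman_unique_fixpoint : exists! v : S -> R, Ahat eps B v /\
  forall s, v s = sup [set F v k | k in [set k : K | (val k).1 = s]].
Proof.
have AhatP v : Ahat eps B v <-> adm v.
  by split=> -[uv vb]; split=> // c; apply/(analyticP bU codS sepU); exact: uv.
exists vlim; split=> [|w [/AhatP aw wT]].
  by split=> [|s]; [exact/AhatP|rewrite {1}vlim_fixed].
have {}wT : w = T w by exact/funext.
apply/funext => s; apply/eqP; rewrite eq_le.
by rewrite (fixed_le aw vlim_adm wT vlim_fixed) (fixed_le vlim_adm aw vlim_fixed wT).
Qed.

End bellman.

(** * Borel subsets of Polish spaces, and the theorem *)

Lemma seq_base_separated (X : topologicalType) (U : nat -> set X) (a b : X) :
  hausdorff_space X -> seq_base U -> (forall n, U n a <-> U n b) -> a = b.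
Proof.
move=> hX [_ UP] ab; apply: contrapT => /eqP; move: hX.
rewrite open_hausdorff => hX /hX[[P Q] [/= aP bQ] [oP oQ /eqP PQ]].
have [n [Ua UPn]] := UP P a oP (set_mem aP).
have : (P `&` Q) b by split; [exact/UPn/ab|exact: set_mem].
by rewrite PQ.
Qed.

Lemma hausdorff_set_type (X : topologicalType) (E : set X) :
  hausdorff_space X -> hausdorff_space (set_type E).
Proof.
move=> hX a b ab; apply: val_inj; apply: hX => P Q nP nQ.
have cv : continuous (val : set_type E -> X).
  exact: (@initial_continuous (set_type E) X val).
have [c [Pc Qc]] := ab _ _ (cv a _ nP) (cv b _ nQ).
by exists (val c).
Qed.

Theorem theorem2 (R : realType) (X Y : completeMetricType R)
  (sepX : separable X) (sepY : separable Y)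
  (S : nonemptyBorel X) (A : nonemptyBorel Y) (K : nonemptyBorel (S * A)%type)
  (K_section : forall s : S, exists a : A, (K : set (S * A)) (s, a))
  (q : R.-pker (borel K) ~> (borel S))
  (b0 b1 beta r p eps B : R) (u : K -> R)
  (u_meas : measurable_fun [set: borel K] u)
  (b0_gt0 : 0 < b0) (b0_lt_b1 : b0 < b1)
  (u_bounds : forall k : K, b0 <= u k <= b1)
  (beta_bounds : 0 <= beta < 1)
  (r_lt0 : r < 0) (p_lt1 : p < 1) (p_neq0 : p != 0)
  (eps_gt0 : 0 < eps) (eps_lt_B : eps < B)
  (const_neg : p < 0 -> eps <= b0 /\ (1 - beta) `^ p^-1 * b1 <= B)
  (const_pos : 0 < p -> eps <= (1 - beta) `^ p^-1 * b0 /\ b1 <= B) :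
  exists! v : S -> R, Ahat eps B v /\ bellman_solution q u beta r p v.
Proof.
have bX := separable_seq_base sepX; have bY := separable_seq_base sepY.
have [U bU] := seq_base_sub (carrier S) bX.
have [V bV] := seq_base_sub (carrier A) bY.
have hS : hausdorff_space (set_type S).
  exact: (hausdorff_set_type (@metric_hausdorff _ X)).
apply: (@bellman_unique_fixpoint R (set_type S) (set_type A) K q u b0 b1
  beta r p eps B U V) => //.
- exact/codable_sub/polish_codable.
- exact/codable_sub/polish_codable.
- by move=> a b; exact: seq_base_separated.
Qed.
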